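(* Let $q=v^2\in\kappa$ be generic for $\Gamma$ and let a pre $W$-graph be given, with vertex set $X$, edge set $Y$, subsets $I_x\subset I$ and constants $\mu^i_{y,x}$. Let $\tau_i$ $(i\in I)$ be the associated operators on the space $\kappa\langle X\rangle$ with basis $X$, and let $(\bar V_i,A^i_{j;v})$ be the associated $\mathbb{Q}_I$-representation. Then $\sigma_i\mapsto\tau_i$ defines a representation of $H_q(\Gamma)$ if and only if the following two conditions hold: (1) $(\bar V_i,A^i_{j;v})$ is an $H$-representation of type $(\Gamma;q)$; (2) for all $i\neq j\in I$, the $1$-eigenspace of $A^j_{i;v}A^i_{j;v}$ is the subspace of $\bar V_i$ spanned by $X_i\cap X_j$.
   Context: $I$ is a finite set, $\Gamma=[m_{i,j}]_{i,j\in I}$ a Coxeter matrix ($m_{i,i}=1$, $m_{i,j}=m_{j,i}\ge2$ finite integers for $i\ne j$), $\kappa$ a field. The numbers $4\cos^2(a\pi/m)$, $m=m_{i,j}$, are regarded as elements of $\kappa$ (i.e. $2+\zeta^a+\zeta^{-a}$ with $\zeta$ a primitive $m$-th root of unity). $H_q(\Gamma)$ is the $\kappa$-algebra generated by $\sigma_i$ ($i\in I$) with relations $\sigma_i\sigma_j\cdots=\sigma_j\sigma_i\cdots$ ($m_{i,j}$ alternating factors on each side) for $i\neq j$, and $(\sigma_i-q)(\sigma_i+1)=0$. $q\in\kappa\setminus\{0\}$ is generic if the dihedral Hecke algebra $H_q(I_{m_{i,j}})$ (two generators, off-diagonal entry $m_{i,j}$) is semisimple for all $i\ne j$; $v\in\kappa$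 satisfies $v^2=q$. Put $\lambda_{m;q}(a)=4\cos^2(a\pi/m)\frac{1}{q+q^{-1}+2}$. A pre $W$-graph consists of a finite set of vertices $X$, a set of edges $Y$ (two-element subsets of $X$), a subset $I_x\subset I$ for each $x\in X$, and for all $x,y,i$ with $\{y,x\}\in Y$ and $i\in I_y\setminus I_x$ a number $0\ne\mu^i_{y,x}\in\kappa$. Put $X_i=\{x\in X: i\in I_x\}$. Operators: $\tau_i(x)=-x$ if $i\in I_x$, and $\tau_i(x)=v^2x+v\sum_{y\in X_i,\ \{y,x\}\in Y}\mu^i_{y,x}\,y$ if $i\notin I_x$. Associated $\mathbb{Q}_I$-representation: $\bar V_i=\kappa\langle X_i\rangle$ (basis $X_i$), and for $j\ne i$, $A^j_{i;v}:\bar V_j\to\bar V_i$ is given by $A^j_{i;v}(x)=x$ if $x\in X_j\cap X_i$, and $A^j_{i;v}(x)=\frac{-1}{v+v^{-1}}\sum_{y\in X_i,\ \{y,x\}\in Y}\mu^i_{y,x}\,y$ if $x\in X_j\setminus X_i$. $(m;q)$-couple: for linear $f:V\to W$, $g:W\to V$, $(f,g)$ is an $(m;q)$-couple between $V$ and $W$ if $gf$, $fg$ are diagonalizable with eigenvalues in $\{1\}\cup\{\lambda_{m;q}(a):1\le a\le[\frac{m-1}{2}]\}$ when $m$ is odd; for $m$ even the eigenvalue $0$ is also allowed, and then it is required that $gf(x)=0\Rightarrow f(x)=0$ and $fg(y)=0\Rightarrow g(y)=0$. $H$-representation of type $(\Gamma;q)$: spaces $V_i$ ($i\in I$) and linear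 maps $A^i_j:V_i\to V_j$ ($i\ne j$) such that, with $V_{i,j}=\ker(A^j_iA^i_j-\mathrm{id})\subset V_i$: (a) $(A^i_j,A^j_i)$ is an $(m_{i,j};q)$-couple for all $i\ne j$; (b) $A^i_k(x)=A^j_kA^i_j(x)$ for distinct $i,j,k$ and $x\in V_{i,j}$; (c) $\mathrm{Im}(A^k_j-A^i_jA^k_i)\subset\mathrm{Im}(\mathrm{id}_{V_j}-A^i_jA^j_i)$ for distinct $i,j,k$.
   Formalization: The implication from (1) and (2) to a representation is proved only when every I_x is nonempty; it fails in general if some I_x is empty (e.g. I={i,j}, m=3, I_z=∅, I_x={i,j}, μ^i_{x,z}≠μ^j_{x,z}). The other implication is proved without restriction. *)

(* Defs.v *)
From HB Require Import structures.
From mathcomp Require Import all_boot all_order all_algebra.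
From mathcomp Require Import boolp.
From mathcomp Require Import generic_quotient ring_quotient.
From mathcomp Require Import monalg.

Set Implicit Arguments.
Unset Strict Implicit.
Unset Printing Implicit Defensive.

Import GRing.Theory.
Local Open Scope ring_scope.

Definition coxeter_matrix (I : finType) (m : I -> I -> nat) : Prop :=
  [/\ forall i, m i i = 1%N,
      forall i j, m i j = m j i &
      forall i j, i != j -> (2 <= m i j)%N].

Definition dihedral_matrix (m : nat) (s t : bool) : nat :=
  if s == t then 1%N else m.

(* a * b * a * ... with n factors *)
Fixpoint alternating (R : nzRingType) (a b : R) (n : nat) : R :=
  if n is n'.+1 then a * alternating b a n' else 1.

Section HeckeAlgebra.
Variables (I : finType) (m : I -> I -> nat) (kappa : fieldType) (q : kappa).

Local Notation free := {malg kappa[{fmonom I}]}.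

Definition free_gen (i : I) : free := << fmu i >>.

Inductive hecke_relator : free -> Prop :=
| BraidRelator i j : i != j ->
    hecke_relator (alternating (free_gen i) (free_gen j) (m i j)
                   - alternating (free_gen j) (free_gen i) (m i j))
| QuadraticRelator i :
    hecke_relator ((free_gen i - q%:A) * (free_gen i + 1)).

Definition two_sided_ideal (J : free -> Prop) : Prop :=
  [/\ J 0,
      forall a b, J a -> J b -> J (a - b) &
      forall u a w, J a -> J (u * a * w)].

Definition hecke_ideal : {pred free} := fun a =>
  `[< forall J, two_sided_ideal J -> (forall r, hecke_relator r -> J r) -> J a >].

Fact hecke_ideal_zmod : zmod_closed hecke_ideal.
Proof.
split=> [|a b /asboolP Ha /asboolP Hb]; apply/asboolP=> J idJ relJ.
  by case: idJ.
by case: (idJ) => _ JB _; apply: JB; [apply: Ha | apply: Hb].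
Qed.

HB.instance Definition _ :=
  GRing.isZmodClosed.Build free hecke_ideal hecke_ideal_zmod.

Fact hecke_idealM u a w : a \in hecke_ideal -> u * a * w \in hecke_ideal.
Proof.
move=> /asboolP Ha; apply/asboolP=> J idJ relJ.
by case: (idJ) => _ _ JM; apply: JM; apply: Ha.
Qed.

(* The character sigma_i |-> q kills the ideal. *)
Fact hecke_ideal1 : 1 \notin hecke_ideal.
Proof.
pose h (w : {fmonom I}) : kappa := q ^+ size w.
have hM : mmorphism h.
  split=> [x y|] /=; first by rewrite /h fmM size_cat exprD.
  by rewrite /h fm1.
pose hh : {mmorphism {fmonom I} -> kappa} :=
  HB.pack h (isMultiplicative.Build _ _ h hM).
have [e [eg ec]] : exists e : {rmorphism free -> kappa},
    (forall i, e (free_gen i) = q) /\ forall c, e c%:A = c.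
  exists (mmap idfun hh); split=> [i|c] /=.
    by rewrite mmapU /= mul1r /h fmU expr1.
  by rewrite (mmapZ (h := hh)) (mmap1 (h := hh)) mulr1.
have ealt i j n : e (alternating (free_gen i) (free_gen j) n) = q ^+ n.
  elim: n i j => [|n IH] i j /=; first by rewrite rmorph1.
  by rewrite rmorphM eg IH exprS.
apply/negP => /asboolP /(_ (fun a => e a = 0)) H.
suff : e 1 = 0 by move/eqP; rewrite rmorph1 oner_eq0.
apply: H.
  split=> [|a b Ha Hb|u a w Ha]; first by rewrite rmorph0.
    by rewrite rmorphB Ha Hb subrr.
  by rewrite !rmorphM Ha mulr0 mul0r.
move=> r [i j _|i]; first by rewrite rmorphB !ealt subrr.
by rewrite rmorphM rmorphB eg ec subrr mul0r.
Qed.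

Definition hecke_algebra : Type := Quotient.quot hecke_ideal.

HB.instance Definition _ := GRing.Zmodule.on hecke_algebra.
HB.instance Definition _ := EqQuotient.on hecke_algebra.

Local Open Scope quotient_scope.
Local Notation pi := (\pi_hecke_algebra).

Fact hecke_piP (x y : free) : (x - y \in hecke_ideal) = (pi x == pi y).
Proof. by rewrite (Quotient.idealrBE _ x y). Qed.

Definition hecke_one : hecke_algebra := lift_cst hecke_algebra 1.
Definition hecke_mul := lift_op2 hecke_algebra *%R.
Definition hecke_scale (c : kappa) := lift_op1 hecke_algebra ( *:%R c).

Fact hecke_pi_one : pi 1 = hecke_one. Proof. by rewrite /hecke_one; unlock. Qed.

Fact hecke_pi_mul : {morph pi : x y / x * y >-> hecke_mul x y}.
Proof.
move=> x y; rewrite /hecke_mul; unlock; apply/eqP; rewrite -hecke_piP.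
rewrite -[x * y](addrNK (x * repr (pi y))) -mulrBr -addrA -mulrBl rpredD //.
  by rewrite -[_ * _]mulr1 hecke_idealM // hecke_piP reprK.
by rewrite -[_ - _]mul1r hecke_idealM // hecke_piP reprK.
Qed.

Fact hecke_pi_scale c : {morph pi : x / c *: x >-> hecke_scale c x}.
Proof.
move=> x; rewrite /hecke_scale; unlock; apply/eqP; rewrite -hecke_piP -scalerBr.
by rewrite -mulr_algl -[_ * _]mulr1 hecke_idealM // hecke_piP reprK.
Qed.

Fact hecke_pi_add : {morph pi : x y / x + y}.
Proof. by move=> x y; rewrite !piE. Qed.

Fact hecke_mulA : associative hecke_mul.
Proof.
by elim/quotW=> x; elim/quotW=> y; elim/quotW=> z; rewrite -!hecke_pi_mul mulrA.
Qed.
Fact hecke_mul1l : left_id hecke_one hecke_mul.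
Proof. by elim/quotW=> x; rewrite -hecke_pi_one -hecke_pi_mul mul1r. Qed.
Fact hecke_mul1r : right_id hecke_one hecke_mul.
Proof. by elim/quotW=> x; rewrite -hecke_pi_one -hecke_pi_mul mulr1. Qed.
Fact hecke_mulDl : left_distributive hecke_mul +%R.
Proof.
elim/quotW=> x; elim/quotW=> y; elim/quotW=> z.
by rewrite -!hecke_pi_add -!hecke_pi_mul mulrDl hecke_pi_add.
Qed.
Fact hecke_mulDr : right_distributive hecke_mul +%R.
Proof.
elim/quotW=> x; elim/quotW=> y; elim/quotW=> z.
by rewrite -!hecke_pi_add -!hecke_pi_mul mulrDr hecke_pi_add.
Qed.
Fact hecke_one_neq0 : hecke_one != 0.
Proof.
have -> : 0 = pi 0 by rewrite !piE.
by rewrite -hecke_pi_one -hecke_piP subr0 hecke_ideal1.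
Qed.

HB.instance Definition _ := GRing.Zmodule_isNzRing.Build hecke_algebra
  hecke_mulA hecke_mul1l hecke_mul1r hecke_mulDl hecke_mulDr hecke_one_neq0.

Fact hecke_scaleA a b x : hecke_scale a (hecke_scale b x) = hecke_scale (a * b) x.
Proof. by elim/quotW: x => x; rewrite -!hecke_pi_scale scalerA. Qed.
Fact hecke_scale1 : left_id 1 hecke_scale.
Proof. by elim/quotW=> x; rewrite -hecke_pi_scale scale1r. Qed.
Fact hecke_scaleDr : right_distributive hecke_scale +%R.
Proof.
move=> c; elim/quotW=> x; elim/quotW=> y.
by rewrite -hecke_pi_add -!hecke_pi_scale scalerDr hecke_pi_add.
Qed.
Fact hecke_scaleDl x : {morph hecke_scale^~ x : a b / a + b}.
Proof. by elim/quotW: x => x a b; rewrite -!hecke_pi_scale scalerDl hecke_pi_add. Qed.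

HB.instance Definition _ := GRing.Zmodule_isLmodule.Build kappa hecke_algebra
  hecke_scaleA hecke_scale1 hecke_scaleDr hecke_scaleDl.

Fact hecke_scaleAl (c : kappa) (x y : hecke_algebra) : c *: (x * y) = c *: x * y.
Proof.
elim/quotW: x => x; elim/quotW: y => y; rewrite /GRing.scale /GRing.mul /=.
by rewrite -!(hecke_pi_mul, hecke_pi_scale) scalerAl.
Qed.

HB.instance Definition _ := GRing.Lmodule_isLalgebra.Build kappa hecke_algebra
  hecke_scaleAl.

Fact malg_scalerAr (c : kappa) (x y : free) : c *: (x * y) = x * (c *: y).
Proof.
apply/malgP=> k; rewrite mcoeffZ mcoeffMl.
rewrite (mcoeffMlw k (finmap.fsubset_refl _) (msuppZ_le c y)) mulr_sumr.
apply: eq_bigr => k1 _; rewrite mulr_sumr; apply: eq_bigr => k2 _.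
by rewrite mcoeffZ mulrnAr mulrCA.
Qed.

Fact hecke_scaleAr (c : kappa) (x y : hecke_algebra) : c *: (x * y) = x * (c *: y).
Proof.
elim/quotW: x => x; elim/quotW: y => y; rewrite /GRing.scale /GRing.mul /=.
by rewrite -!(hecke_pi_mul, hecke_pi_scale) malg_scalerAr.
Qed.

HB.instance Definition _ := GRing.Lalgebra_isAlgebra.Build kappa hecke_algebra
  hecke_scaleAr.

Definition hecke_proj (x : free) : hecke_algebra := pi x.

Fact hecke_proj_linear : linear hecke_proj.
Proof.
by move=> c x y; rewrite /hecke_proj hecke_pi_add hecke_pi_scale.
Qed.

Fact hecke_proj_monoid : monoid_morphism hecke_proj.
Proof.
split; first by rewrite /hecke_proj hecke_pi_one.
by move=> x y; rewrite /hecke_proj hecke_pi_mul.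
Qed.

HB.instance Definition _ :=
  GRing.isLinear.Build kappa free hecke_algebra _ hecke_proj hecke_proj_linear.
HB.instance Definition _ :=
  GRing.isMonoidMorphism.Build free hecke_algebra hecke_proj hecke_proj_monoid.

Fact hecke_proj_eq0 x : (hecke_proj x == 0) = (x \in hecke_ideal).
Proof.
have -> : 0 = hecke_proj 0 by rewrite linear0.
by rewrite -hecke_piP subr0.
Qed.

Fact hecke_proj_surj (y : hecke_algebra) : exists x, y = hecke_proj x.
Proof. by elim/quotW: y => x; exists x. Qed.

Definition hecke_gen (i : I) : hecke_algebra := hecke_proj (free_gen i).

End HeckeAlgebra.

Definition left_ideal (R : nzRingType) (L : R -> Prop) : Prop :=
  [/\ L 0,
      forall x y, L x -> L y -> L (x + y) &
      forall a x, L x -> L (a * x)].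

(* Every submodule of the regular left module has a complement. *)
Definition semisimple (R : nzRingType) : Prop :=
  forall L : R -> Prop, left_ideal L ->
  exists L' : R -> Prop,
    [/\ left_ideal L',
        forall x, L x -> L' x -> x = 0 &
        forall x, exists y z, [/\ L y, L' z & x = y + z]].

Definition generic (I : finType) (m : I -> I -> nat) (kappa : fieldType)
    (q : kappa) : Prop :=
  q != 0 /\
  forall i j, i != j -> semisimple (hecke_algebra (dihedral_matrix (m i j)) q).

Definition representation (kappa : fieldType) (A : algType kappa)
    (V : vectType kappa) (rho : A -> 'End(V)) : Prop :=
  [/\ linear rho, rho 1 = \1%VF & forall a b, rho (a * b) = (rho a \o rho b)%VF].

Definition defines_hecke_representation (I : finType) (m : I -> I -> nat)
    (kappa : fieldType) (q : kappa) (V : vectType kappa) (tau : I -> 'End(V)) :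
    Prop :=
  exists rho : hecke_algebra m q -> 'End(V),
    representation rho /\ forall i, rho (hecke_gen m q i) = tau i.

(* c a is 4 cos^2 (a pi / m) regarded as an element of kappa; the primitive m-th
   root of unity zeta itself may live in an extension of kappa. *)
Definition four_cos_sq (kappa : fieldType) (m : nat) (c : nat -> kappa) : Prop :=
  exists (L : fieldType) (iota : {rmorphism kappa -> L}) (zeta : L),
    m.-primitive_root zeta /\
    forall a, iota (c a) = 2 + zeta ^+ a + zeta ^- a.

Section HRepresentation.
Variables (kappa : fieldType) (q : kappa).

(* c m a stands for 4 cos^2 (a pi / m). *)
Variable c : nat -> nat -> kappa.

Definition lambda (m a : nat) : kappa := c m a * (q + q^-1 + 2)^-1.

Definition couple_eigenvalue (m : nat) (l : kappa) : Prop :=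
  [\/ l = 1,
      exists2 a, (1 <= a <= m.-1./2)%N & l = lambda m a |
      ~~ odd m /\ l = 0].

Definition diagonalizable_end (V : vectType kappa) (f : 'End(V)) : Prop :=
  exists2 b : seq V, basis_of fullv b &
    forall x, x \in b -> exists l, f x = l *: x.

Definition couple (m : nat) (V W : vectType kappa)
    (f : 'Hom(V, W)) (g : 'Hom(W, V)) : Prop :=
  [/\ diagonalizable_end (g \o f)%VF /\ diagonalizable_end (f \o g)%VF,
      forall l, passmx.leigenvalue (g \o f)%VF l -> couple_eigenvalue m l,
      forall l, passmx.leigenvalue (f \o g)%VF l -> couple_eigenvalue m l &
      ~~ odd m ->
        (forall x, g (f x) = 0 -> f x = 0) /\
        (forall y, f (g y) = 0 -> g y = 0)].

(* The argument A i j is A^i_j : V_i -> V_j; A i i plays no role. *)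
Definition H_representation (I : finType) (m : I -> I -> nat)
    (V : I -> vectType kappa) (A : forall i j, 'Hom(V i, V j)) : Prop :=
  [/\ forall i j, i != j -> couple (m i j) (A i j) (A j i),
      forall i j k, i != j -> j != k -> i != k ->
        forall x, x \in lker ((A j i \o A i j) - \1)%VF ->
          A i k x = A j k (A i j x) &
      forall i j k, i != j -> j != k -> i != k ->
        (limg (A k j - (A i j \o A k i))%VF <= limg (\1 - (A i j \o A j i))%VF)%VS].

End HRepresentation.

Section FreeSpace.
Variables (kappa : fieldType) (T : finType).

Definition basis_vec (x : T) : {ffun T -> kappa^o} := [ffun y => (y == x)%:R].

Definition extend_fun (W : vectType kappa) (F : T -> W)
    (u : {ffun T -> kappa^o}) : W := \sum_x (u x : kappa) *: F x.

Fact extend_fun_linear (W : vectType kappa) (F : T -> W) :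
  linear (extend_fun F).
Proof.
move=> a u w; rewrite /extend_fun scaler_sumr -big_split /=.
by apply: eq_bigr => x _; rewrite !ffunE scalerDl scalerA.
Qed.

HB.instance Definition _ (W : vectType kappa) (F : T -> W) :=
  GRing.isLinear.Build kappa {ffun T -> kappa^o} W _ (extend_fun F)
    (extend_fun_linear F).

(* linfun is meaningful only on linear functions, whence extend_fun_linear. *)
Definition linear_extension (W : vectType kappa) (F : T -> W) :
  'Hom({ffun T -> kappa^o}, W) := linfun (extend_fun F).

Fact linear_extension_basis (W : vectType kappa) (F : T -> W) x :
  linear_extension F (basis_vec x) = F x.
Proof.
rewrite lfunE /= /extend_fun (bigD1 x) //= ffunE eqxx scale1r big1 ?addr0 //.
by move=> y /negPf yx; rewrite ffunE yx scale0r.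
Qed.

End FreeSpace.

(* mu i y x is only meaningful when {y, x} is an edge and i \in I_y \ I_x. *)
Record preWgraph (kappa : fieldType) (I : finType) := PreWgraph {
  vertex : finType;
  edges : {set {set vertex}};
  label : vertex -> {set I};
  mu : I -> vertex -> vertex -> kappa;
  edges_card2 : forall e, e \in edges -> #|e| = 2;
  mu_neq0 : forall i x y, [set y; x] \in edges ->
    i \in label y :\: label x -> mu i y x != 0
}.

(* Labels are allowed to be empty in a preWgraph. Conditions on the maps Abar
   do not see the constants mu i y x with label x = set0, so they cannot imply
   the braid relations there: take I = {i, j}, m i j = 3, vertices z and x
   joined by an edge, label z = set0, label x = {i, j} and
   mu i x z <> mu j x z; both Vbar i and Vbar j are lines and both Abar maps
   are the identity, but the coefficients of x in tau_i tau_j tau_i z and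
   tau_j tau_i tau_j z differ by v (q^2 + q + 1) (mu i x z - mu j x z). *)
Definition nonempty_labels (kappa : fieldType) (I : finType)
    (G : preWgraph kappa I) : Prop :=
  forall x : vertex G, label x != set0.

Section WgraphOperators.
Variables (kappa : fieldType) (I : finType) (v : kappa) (G : preWgraph kappa I).

(* X_i *)
Definition labelled (i : I) : {set vertex G} := [set x | i \in label x].

Definition tau (i : I) : 'End({ffun vertex G -> kappa^o}) :=
  linear_extension (fun x : vertex G =>
    if x \in labelled i then - basis_vec kappa x
    else v ^+ 2 *: basis_vec kappa x
       + v *: \sum_(y in labelled i | [set y; x] \in edges G)
                mu i y x *: basis_vec kappa y).

Definition Vbar_index (i : I) : finType := {x : vertex G | x \in labelled i}.

Definition Vbar (i : I) : vectType kappa := {ffun Vbar_index i -> kappa^o}.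

(* Abar j i is A^j_{i;v} : Vbar_j -> Vbar_i; insub (val x) is Some x' exactly when
   the vertex x of X_j is also in X_i. *)
Definition Abar (j i : I) : 'Hom(Vbar j, Vbar i) :=
  linear_extension (fun x : Vbar_index j =>
    if insub (val x) is Some x' then basis_vec kappa (x' : Vbar_index i)
    else (- 1 / (v + v^-1)) *:
      \sum_(y : Vbar_index i | [set val y; val x] \in edges G)
        mu i (val y) (val x) *: basis_vec kappa y).

Definition Abar_eigenspace_condition : Prop :=
  forall i j, i != j ->
    passmx.leigenspace (Abar j i \o Abar i j)%VF 1
    = <<[seq basis_vec kappa x | x in [pred x : Vbar_index i | val x \in labelled j]]>>%VS.

End WgraphOperators.

(* Main.v *)
Require Import Defs.
From HB Require Import structures.
From mathcomp Require Import all_boot all_order all_algebra.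
From mathcomp Require Import boolp generic_quotient finmap monalg.
From mathcomp Require Import ring zify.

Set Implicit Arguments.
Unset Strict Implicit.
Unset Printing Implicit Defensive.

Import GRing.Theory.
Local Open Scope ring_scope.

(** Write the quadratic relation as [tau_i = q - v C_i] with [C_i^2 = (v + v^-1) C_i];
    then [C_i = (v + v^-1) iota_i pi_i], where [iota_i] includes the span of [X_i]
    and [pi_i] is a retraction onto it, and [A^i_j = pi_j iota_i].  For a pair
    [i, j], the difference of the two alternating products of length [m] is
    [(- v)^m] times the difference of two Chebyshev-type expressions in [C_i]
    and [C_j], the analogues of the Kazhdan-Lusztig element of the longest word.
    These expressions are [iota_i P (A^j_i A^i_j) pi_i] for [m] odd, and
    [iota_i P (A^j_i A^i_j) A^j_i pi_j] for [m] even, up to one common scalar,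
    where the roots of [P] are exactly the [lambda_{m;q}(a)].  Evaluating this
    equality on the images of [iota_i] and [iota_j] gives the couple condition
    and the description of the [1]-eigenspace; evaluating it elsewhere gives
    condition (c).  The computation can be reversed; it uses genericity only
    through [v + v^-1 != 0] and [P(1) != 0], both of which follow from
    semisimplicity by exhibiting two-dimensional non-split extensions. *)

(** * Dihedral polynomials and their roots *)

(* With t = y^2 + 2 + y^-2 and [n] = (y^n - y^-n) / (y - y^-1), the value of
   dihedral_poly n at t is [n] for n odd, and [n] / [2] for n even. *)
Fixpoint dihedral_poly (F : fieldType) (n : nat) : {poly F} :=
  if n is n1.+1 then
    if n1 is n2.+1 then
      (if odd n2 then 'X * dihedral_poly F n1 else dihedral_poly F n1)
      - dihedral_poly F n2
    else 1
  else 0.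

Section DihedralPoly.
Variable F : fieldType.
Local Notation dihedral_poly := (dihedral_poly F).

Lemma dihedral_polySS n : dihedral_poly n.+2 =
  (if odd n then 'X * dihedral_poly n.+1 else dihedral_poly n.+1)
  - dihedral_poly n.
Proof. by []. Qed.

(** The degree grows only every second step, when the recursion multiplies by ['X], and the
    subtracted term always has smaller degree. *)
Lemma dihedral_poly_monic_size n :
  dihedral_poly n.+1 \is monic /\ size (dihedral_poly n.+1) = n./2.+1.
Proof.
suff: (dihedral_poly n.+1 \is monic /\ size (dihedral_poly n.+1) = n./2.+1) /\
  (dihedral_poly n.+2 \is monic /\ size (dihedral_poly n.+2) = n.+1./2.+1).
  by case.
elim: n => [|n [[m1 s1] [m2 s2]]].
  by rewrite /= subr0 monic1 size_poly1.
split=> //; rewrite dihedral_polySS.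
set p := (if _ then _ else _).
have [mp sp] : p \is monic /\ size p = n.+2./2.+1.
  rewrite /p; case: ifP => on.
    by rewrite mulrC rpredM ?monicX // size_mulX ?monic_neq0 // s2; split; lia.
  by split=> //; rewrite s2; move: on => /=; lia.
have lt_s : (size (- dihedral_poly n.+1) < size p)%N.
  by rewrite size_polyN s1 sp; lia.
by rewrite monicE lead_coefDl // size_polyDl // -monicE.
Qed.

(** The closed form of the quantum integers at [z = y ^+ 2], cleared of denominators so that it also
    holds for [z = 1] and [z = -1]. *)
Lemma dihedral_poly_geometric (z : F) k : z != 0 ->
  (z - 1) * z ^+ k * (dihedral_poly k.*2.+1).[2 + z + z^-1] = z ^+ k.*2.+1 - 1 /\
  (z ^+ 2 - 1) * z ^+ k * (dihedral_poly k.*2).[2 + z + z^-1]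
    = z * (z ^+ k.*2 - 1).
Proof.
move=> z0; elim: k => [|k [IHo IHe]].
  by rewrite /= !hornerE; split; ring.
rewrite doubleS !dihedral_polySS /= odd_double /= !hornerE.
set p1 := (dihedral_poly k.*2.+1).[_] in IHo *.
set p0 := (dihedral_poly k.*2).[_] in IHe *.
rewrite -mul2n in IHo IHe *; rewrite !exprS ?expr0 ?mulr1 !exprM in IHo IHe *.
have -> : (z - 1) * (z * z ^+ k) * ((2 + z + z^-1) * (p1 - p0) - p1) =
  (z + 1) ^+ 2 * ((z - 1) * z ^+ k * p1) - (z + 1) * ((z * z - 1) * z ^+ k * p0)
  - z * ((z - 1) * z ^+ k * p1) by field.
have -> : (z * z - 1) * (z * z ^+ k) * (p1 - p0) =
   z * (z + 1) * ((z - 1) * z ^+ k * p1) - z * ((z * z - 1) * z ^+ k * p0) by ring.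
by rewrite IHo IHe; split; ring.
Qed.

(** The right side of the closed form vanishes, and the factor [z - 1] ([m] odd) or [z ^+ 2 - 1]
    ([m] even) on the left does not. *)
Lemma dihedral_poly_root (z : F) m : z != 0 -> z ^+ m = 1 -> z != 1 ->
  (~~ odd m -> z ^+ 2 != 1) -> (dihedral_poly m).[2 + z + z^-1] = 0.
Proof.
move=> z0 zm z1 z2.
have [ho he] := dihedral_poly_geometric m./2 z0.
have zk : z ^+ m./2 != 0 by rewrite expf_neq0.
case: (boolP (odd m)) => om.
  rewrite -(odd_double_half m) om add1n in zm *.
  move/eqP: ho; rewrite zm subrr !mulf_eq0 subr_eq0 (negPf z1) (negPf zk) /=.
  by move/eqP.
rewrite -(odd_double_half m) (negPf om) add0n in zm *.
move/eqP: he; rewrite zm subrr mulr0 !mulf_eq0 subr_eq0 (negPf (z2 om)) (negPf zk).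
by move/eqP.
Qed.
End DihedralPoly.

Arguments dihedral_poly : simpl never.

(** The root of unity may live only in an extension field; this lets the roots be checked there. *)
Lemma map_dihedral_poly (K L : fieldType) (f : {rmorphism K -> L}) n :
  map_poly f (dihedral_poly K n) = dihedral_poly L n.
Proof.
suff: map_poly f (dihedral_poly K n) = dihedral_poly L n /\
      map_poly f (dihedral_poly K n.+1) = dihedral_poly L n.+1 by case.
elim: n => [|n [IH1 IH2]]; first by rewrite /dihedral_poly rmorph0 rmorph1.
split=> //; rewrite !dihedral_polySS rmorphB /= IH1 -IH2.
by case: ifP => // _; rewrite rmorphM /= map_polyX.
Qed.

Lemma primitive_root_neq0 (K : fieldType) m (z : K) :
  m.-primitive_root z -> z != 0.
Proof.
move=> prim; apply/eqP => z0; have := prim_expr_order prim.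
rewrite z0 expr0n gtn_eqF ?(prim_order_gt0 prim) // => /eqP.
by rewrite eq_sym oner_eq0.
Qed.

(** The number is [(zeta ^+ a + 1) ^+ 2 / zeta ^+ a], and [zeta ^+ a = -1] would force [m] to divide
    [2 a], which lies strictly between [0] and [m]. *)
Lemma four_cos_sq_eq0 (K : fieldType) m (c : nat -> K) a :
  four_cos_sq m c -> (0 < a <= m.-1./2)%N -> c a != 0.
Proof.
case=> L [iota [zeta [prim ca]]] ha; rewrite -(fmorph_eq0 iota) ca.
have z0 := primitive_root_neq0 prim.
have za0 : zeta ^+ a != 0 by rewrite expf_neq0.
have -> : 2 + zeta ^+ a + zeta ^- a = (zeta ^+ a + 1) ^+ 2 / zeta ^+ a by field.
rewrite mulf_neq0 ?invr_eq0 // expf_neq0 // addr_eq0; apply/eqP => e.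
have : zeta ^+ (a * 2) == 1 by rewrite exprM e sqrrN expr1n.
rewrite -(prim_order_dvd prim) => /dvdn_leq; lia.
Qed.

(** Up to a unit the difference is [(zeta ^+ a - zeta ^+ b) * (1 - zeta ^+ (a + b))], where
    [0 < a + b < m]. *)
Lemma four_cos_sq_inj (K : fieldType) m (c : nat -> K) a b :
  four_cos_sq m c -> (0 < a <= m.-1./2)%N -> (0 < b <= m.-1./2)%N ->
  c a = c b -> a = b.
Proof.
case=> L [iota [zeta [prim ca]]] ha hb /(congr1 iota); rewrite !ca.
have z0 := primitive_root_neq0 prim.
have za0 : zeta ^+ a != 0 by rewrite expf_neq0.
have zb0 : zeta ^+ b != 0 by rewrite expf_neq0.
move=> e.
have : (zeta ^+ a - zeta ^+ b) * (1 - zeta ^+ (a + b)) == 0.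
  rewrite exprD.
  have -> : (zeta ^+ a - zeta ^+ b) * (1 - zeta ^+ a * zeta ^+ b) =
    zeta ^+ a * zeta ^+ b * ((2 + zeta ^+ b + zeta ^- b) - (2 + zeta ^+ a + zeta ^- a)).
    by field; rewrite za0.
  by rewrite e subrr mulr0.
rewrite mulf_eq0 !subr_eq0 => /orP[|]; last first.
  by rewrite eq_sym -(prim_order_dvd prim) => /dvdn_leq; lia.
by rewrite (eq_prim_root_expr prim) !modn_small; [move/eqP | lia | lia].
Qed.

(** A monic polynomial of degree [m.-1./2] with that many distinct roots. For [m = 2] the list is
    empty, and asking for a primitive square root of unity would exclude characteristic 2. *)
Lemma dihedral_poly_factor (K : fieldType) m (c : nat -> K) : (2 <= m)%N ->
  ((2 < m)%N -> four_cos_sq m c) ->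
  dihedral_poly K m = \prod_(x <- [seq c a | a <- iota 1 m.-1./2]) ('X - x%:P).
Proof.
case: m => [//|m] m2 cosP /=.
have [mon sz] := dihedral_poly_monic_size K m.
rewrite [LHS](all_roots_prod_XsubC (rs := [seq c a | a <- iota 1 m./2])).
- by rewrite (eqP mon) scale1r.
- by rewrite sz size_map size_iota.
- apply/allP => x /mapP[a]; rewrite mem_iota => ha ->.
  case: (cosP _) => [|L [i [zeta [prim ca]]]]; first by lia.
  rewrite rootE -(fmorph_eq0 i) -horner_map map_dihedral_poly ca.
  have z0 := primitive_root_neq0 prim.
  apply/eqP; apply: dihedral_poly_root.
  + by rewrite expf_neq0.
  + by rewrite exprAC (prim_expr_order prim) expr1n.
  + rewrite -(prim_order_dvd prim); apply/negP => /dvdn_leq; lia.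
  + move=> om; rewrite -exprM -(prim_order_dvd prim); apply/negP => /dvdn_leq.
    by move: om => /=; lia.
- rewrite uniq_rootsE map_inj_in_uniq ?iota_uniq // => a b.
  by rewrite !mem_iota => ha hb; apply: (four_cos_sq_inj (cosP _)); lia.
Qed.

(** * Polynomials in an endomorphism *)

(** Spelled out as a sum because [V] may be zero, and then ['End(V)] is the zero ring. *)
Definition poly_act (K : fieldType) (V : vectType K) (p : {poly K})
    (f : 'End(V)) : 'End(V) :=
  \sum_(i < size p) p`_i *: iter i (fun g => f \o g)%VF \1%VF.

Section PolyAct.
Variables (K : fieldType) (V : vectType K).
Implicit Types (p q : {poly K}) (f : 'End(V)).

Let poly_act_wide n p f : (size p <= n)%N ->
  poly_act p f = \sum_(i < n) p`_i *: iter i (fun g => f \o g)%VF \1%VF.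
Proof.
move=> sp; rewrite /poly_act.
rewrite (big_ord_widen n (fun i => p`_i *: iter i (fun g => f \o g)%VF \1%VF) sp).
rewrite big_mkcond; apply: eq_bigr => i _; case: ltnP => // le_p.
by rewrite nth_default // scale0r.
Qed.

Lemma poly_actD p q f w : poly_act (p + q) f w = poly_act p f w + poly_act q f w.
Proof.
pose n := maxn (size p) (size q).
rewrite !(@poly_act_wide n) ?leq_maxl ?leq_maxr ?size_polyD //.
by rewrite -add_lfunE -big_split; congr (fun_of_lfun _ _); apply: eq_bigr => i _;
  rewrite coefD scalerDl.
Qed.

Lemma poly_actZ a p f w : poly_act (a *: p) f w = a *: poly_act p f w.
Proof.
rewrite (@poly_act_wide (size p)) ?size_scale_leq // -scale_lfunE scaler_sumr.
by congr (fun_of_lfun _ _); apply: eq_bigr => i _; rewrite coefZ scalerA.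
Qed.

Lemma poly_actC a f w : poly_act a%:P f w = a *: w.
Proof.
rewrite (@poly_act_wide 1) ?size_polyC ?leq_b1 // big_ord1 coefC /=.
by rewrite scale_lfunE id_lfunE.
Qed.

Lemma poly_actXM p f w : poly_act ('X * p) f w = f (poly_act p f w).
Proof.
rewrite mulrC (@poly_act_wide (size p).+1); last first.
  by have [->|p0] := eqVneq p 0; rewrite ?mul0r ?size_poly0 // size_mulX.
rewrite big_ord_recl coefMX eqxx scale0r add0r !sum_lfunE linear_sum.
apply: eq_bigr => i _.
by rewrite lift0 coefMX /= !scale_lfunE comp_lfunE linearZ.
Qed.

Lemma poly_act0 f w : poly_act 0 f w = 0.
Proof. by rewrite poly_actC scale0r. Qed.

Lemma poly_act1 f w : poly_act 1 f w = w.
Proof. by rewrite poly_actC scale1r. Qed.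

Lemma poly_actB p q f w : poly_act (p - q) f w = poly_act p f w - poly_act q f w.
Proof. by rewrite poly_actD -scaleN1r poly_actZ scaleN1r. Qed.

Lemma poly_act_cons p a f w :
  poly_act (p * 'X + a%:P) f w = f (poly_act p f w) + a *: w.
Proof. by rewrite poly_actD poly_actC mulrC poly_actXM. Qed.

Lemma poly_actM p q f w : poly_act (p * q) f w = poly_act p f (poly_act q f w).
Proof.
elim/poly_ind: p => [|p a IH]; first by rewrite mul0r !poly_act0.
rewrite poly_act_cons -IH -poly_actXM -poly_actZ -poly_actD.
by congr (poly_act _ f w); rewrite mulrDl mul_polyC mulrAC [X in X + _]mulrC.
Qed.

Lemma poly_actXC a f w : poly_act ('X - a%:P) f w = f w - a *: w.
Proof. by rewrite poly_actB poly_actC -['X]mulr1 poly_actXM poly_act1. Qed.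

Lemma poly_act_eigen p f w a : f w = a *: w -> poly_act p f w = p.[a] *: w.
Proof.
move=> fw; elim/poly_ind: p => [|p b IH]; first by rewrite poly_act0 horner0 scale0r.
rewrite poly_act_cons IH linearZ /= fw scalerA -scalerDl.
by rewrite hornerD hornerMX hornerC mulrC.
Qed.

End PolyAct.

Lemma poly_act_intertwine (K : fieldType) (V W : vectType K) (g : 'Hom(V, W))
    (f : 'End(V)) (f' : 'End(W)) p w :
  (forall x, g (f x) = f' (g x)) -> g (poly_act p f w) = poly_act p f' (g w).
Proof.
move=> gf; elim/poly_ind: p => [|p b IH]; first by rewrite !poly_act0 linear0.
by rewrite !poly_act_cons linearD linearZ /= gf IH.
Qed.

(** * Diagonalizability from an annihilating polynomial with simple roots *)

Section Diagonalization.
Variables (K : fieldType) (V : vectType K).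

Lemma exists_sub_basis (X : seq V) :
  exists2 Y : seq V, {subset Y <= X} & basis_of <<X>>%VS Y.
Proof.
elim: X => [|x X [Y sYX bY]]; first by exists [::]; rewrite ?span_nil ?nil_basis.
have [xY|xY] := boolP (x \in <<X>>%VS).
  exists Y => [y /sYX|]; first by rewrite inE orbC => ->.
  suff -> : <<x :: X>>%VS = <<X>>%VS by [].
  by rewrite span_cons; apply/addv_idPr; rewrite -memvE.
exists (x :: Y) => [y|].
  by rewrite !inE => /orP[->//|/sYX ->]; rewrite orbT.
rewrite /basis_of free_cons !span_cons (span_basis bY) xY (basis_free bY).
by rewrite eqxx.
Qed.

Lemma diagonalizable_end_span (f : 'End(V)) (X : seq V) :
  <<X>>%VS = fullv -> (forall x, x \in X -> exists l, f x = l *: x) ->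
  diagonalizable_end f.
Proof.
move=> sX eX; have [Y sYX bY] := exists_sub_basis X.
by exists Y => [|x /sYX /eX //]; rewrite -sX.
Qed.

(** Partial fractions, one root at a time: [f w - a *: w] is a sum of eigenvectors [u x]; dividing
    each by [x - a] and subtracting the result from [w] leaves an [a]-eigenvector. *)
Lemma poly_act_roots_sum (f : 'End(V)) (s : seq K) w :
  uniq s -> poly_act (\prod_(x <- s) ('X - x%:P)) f w = 0 ->
  exists2 u : K -> V, forall x, f (u x) = x *: u x & w = \sum_(x <- s) u x.
Proof.
elim: s w => [|a s IH] w.
  rewrite !big_nil poly_act1 => _ ->; exists (fun=> 0) => [x|]; last by rewrite big_nil.
  by rewrite linear0 scaler0.
rewrite big_cons mulrC poly_actM => /andP[as_ us] /(IH _ us) [u fu].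
rewrite poly_actXC => e.
pose u' x := if x == a then w - \sum_(x <- s) (x - a)^-1 *: u x
             else (x - a)^-1 *: u x.
exists u' => [x|]; last first.
  rewrite big_cons {1}/u' eqxx.
  rewrite [X in _ + X](_ : _ = \sum_(x <- s) (x - a)^-1 *: u x) ?subrK //.
  rewrite big_seq [RHS]big_seq; apply: eq_bigr => x xs; rewrite /u'.
  by case: eqP => // xa; move: as_; rewrite -xa xs.
rewrite /u'; case: eqP => [->|_]; last by rewrite linearZ /= fu !scalerA mulrC.
rewrite linearB linear_sum /= scalerBr -[f w](subrK (a *: w)) e addrAC addrC.
congr (_ + _); rewrite scaler_sumr -sumrB -sumrN big_seq [RHS]big_seq.
apply: eq_bigr => y ys; rewrite linearZ /= fu !scalerA -{1}[u y]scale1r.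
rewrite -scalerBl -scaleNr; congr (_ *: _); field; rewrite subr_eq0.
by apply: contraNneq as_ => <-.
Qed.

Lemma diagonalizable_end_roots (f : 'End(V)) (s : seq K) :
  uniq s -> (forall w, poly_act (\prod_(x <- s) ('X - x%:P)) f w = 0) ->
  diagonalizable_end f.
Proof.
move=> us f0.
pose X := flatten [seq (vbasis (passmx.leigenspace f x) : seq V) | x <- s].
apply: (@diagonalizable_end_span f X) => [|x].
  apply/vspaceP => w; rewrite memvf.
  have [u fu ->] := poly_act_roots_sum us (f0 w).
  rewrite big_seq; apply: memv_suml => x xs.
  have : u x \in passmx.leigenspace f x.
    by apply/eqlfunP; rewrite fu scale_lfunE id_lfunE.
  rewrite -(span_basis (vbasisP (passmx.leigenspace f x))) => ux.
  apply: (subvP _ _ ux); apply: sub_span => y yx.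
  by apply/flattenP; exists (tval (vbasis (passmx.leigenspace f x))) => //; apply/mapP; exists x.
case/flattenP => _ /mapP[y _ ->] /vbasis_mem /eqlfunP.
by rewrite scale_lfunE id_lfunE => ->; exists y.
Qed.

Lemma leigenvalueP (f : 'End(V)) a :
  reflect (exists2 w, f w = a *: w & w != 0) (passmx.leigenvalue f a).
Proof.
apply: (iffP idP) => [|[w fw w0]].
  rewrite /passmx.leigenvalue -vpick0 => p0; exists (vpick (passmx.leigenspace f a)) => //.
  have /eqlfunP := memv_pick (passmx.leigenspace f a).
  by rewrite scale_lfunE id_lfunE.
apply: contraNneq w0 => e0; rewrite -memv0 -e0.
by apply/eqlfunP; rewrite scale_lfunE id_lfunE.
Qed.

Lemma leigenvalue_root (f : 'End(V)) p a :
  (forall w, poly_act p f w = 0) -> passmx.leigenvalue f a -> p.[a] = 0.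
Proof.
move=> pf /leigenvalueP[w fw w0]; have := pf w; rewrite (poly_act_eigen _ fw).
by move/eqP; rewrite scaler_eq0 (negPf w0) orbF => /eqP.
Qed.

(** Reduces linear claims to eigenvectors while recording which eigenvalue occurs. *)
Lemma diagonalizable_end_ind (f : 'End(V)) (P : V -> Prop) :
  diagonalizable_end f -> P 0 ->
  (forall a x y, P x -> P y -> P (a *: x + y)) ->
  (forall a x, passmx.leigenvalue f a -> f x = a *: x -> P x) ->
  forall x, P x.
Proof.
move=> [b bb eb] P0 PD Pe x.
rewrite (coord_basis (bb : basis_of fullv (in_tuple b)) (memvf x)).
elim/big_ind: _ => // [y z Py Pz|i _]; first by rewrite -[y]scale1r; apply: PD.
rewrite -[_ *: _]addr0; apply: PD => //.
have xb : (in_tuple b)`_i \in b by apply: mem_nth.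
have [l fl] := eb _ xb; apply: (Pe l) => //.
by apply/leigenvalueP; eexists; [exact: fl | exact: basis_not0 bb xb].
Qed.
End Diagonalization.

(** * Alternating products and the Chebyshev recursion *)

Fixpoint alt_iter (T : Type) (f g : T -> T) (n : nat) (w : T) : T :=
  if n is n'.+1 then f (alt_iter g f n' w) else w.

(* For f = T_s + v and g = T_t + v with T_s, T_t the generators normalized by
   (T + v) (T - v^-1) = 0, this is the Kazhdan-Lusztig element of the word
   s t s ... of length n. *)
Fixpoint cheb_iter (V : zmodType) (f g : V -> V) (n : nat) (w : V) : V :=
  if n is n1.+1 then
    if n1 is n2.+1 then f (cheb_iter g f n1 w) - cheb_iter f g n2 w else f w
  else 0.

Lemma cheb_iterSS (V : zmodType) (f g : V -> V) n (w : V) :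
  cheb_iter f g n.+2 w = f (cheb_iter g f n.+1 w) - cheb_iter f g n w.
Proof. by []. Qed.

Section ChebIter.
Variables (K : fieldType) (V : vectType K) (v d : K).
Hypothesis vd : v * d = v ^+ 2 + 1.

(** Both terms of the recursion start with [f], which acts on its own image as [d]. *)
Lemma cheb_iter_eigen (f g : 'End(V)) n (w : V) :
  (forall x, f (f x) = d *: f x) ->
  f (cheb_iter f g n w) = d *: cheb_iter f g n w.
Proof.
move=> ff; suff: f (cheb_iter f g n w) = d *: cheb_iter f g n w /\
  f (cheb_iter f g n.+1 w) = d *: cheb_iter f g n.+1 w by case.
elim: n => [|n [IH1 IH2]]; first by rewrite /= linear0 scaler0 ff.
by split=> //; rewrite cheb_iterSS linearB /= ff IH1 scalerBr.
Qed.

(** Sorts the Bruhat interval below the word of length [n.+1]: the word itself, the word of length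
    [n] with the same first letter, and everything below the other word of length [n]. The value [0]
    of [cheb_iter] at [n = 0] keeps the identity from being counted twice. *)
Lemma cheb_iter_rec (f g : 'End(V)) (hf hg : V -> V) n (w : V) :
  (forall x, f (f x) = d *: f x) -> (forall x, g (g x) = d *: g x) ->
  (forall x, f x = hf x + v *: x) -> (forall x, g x = hg x + v *: x) ->
  cheb_iter f g n.+1 w =
    alt_iter hf hg n.+1 w + v *: alt_iter hf hg n w + v *: cheb_iter g f n w.
Proof.
move=> ff gg fE gE.
elim: n f g hf hg ff gg fE gE => [|n IH] f g hf hg ff gg fE gE.
  by rewrite /= scaler0 addr0.
rewrite cheb_iterSS (IH g f hg hf) // linearD linearZ /= (cheb_iter_eigen _ _ _ ff).
rewrite scalerA vd scalerDl scale1r addrA addrK linearD linearZ /=.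
rewrite [f (hg _)]fE [f (alt_iter _ _ _ _)]fE !scalerDr !scalerA -expr2.
set a := hf _; set b := hg _; set a' := v *: hf _; set b' := v ^+ 2 *: _.
by rewrite !addrA; congr (_ + _ + _); rewrite -!addrA [v *: b + _]addrC addrA.
Qed.

(** In [cheb_iter_rec] the terms below the top word are, by induction, symmetric in [f] and [g], so
    they cancel. *)
Lemma cheb_iter_diff (f g : 'End(V)) (hf hg : V -> V) n (w : V) :
  (forall x, f (f x) = d *: f x) -> (forall x, g (g x) = d *: g x) ->
  (forall x, f x = hf x + v *: x) -> (forall x, g x = hg x + v *: x) ->
  cheb_iter f g n w - cheb_iter g f n w = alt_iter hf hg n w - alt_iter hg hf n w.
Proof.
move=> ff gg fE gE; elim: n => [|n IH]; first by rewrite /= !subrr.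
rewrite (cheb_iter_rec n w ff gg fE gE) (cheb_iter_rec n w gg ff gE fE).
set a := alt_iter _ _ n.+1 w; set b := alt_iter _ _ n.+1 w.
rewrite -[a + _ + _]addrA -[b + _ + _]addrA -!scalerDr opprD addrACA -scalerBr.
have -> : alt_iter hf hg n w + cheb_iter g f n w
   - (alt_iter hg hf n w + cheb_iter f g n w) = 0; last by rewrite scaler0 addr0.
by rewrite opprD addrACA -IH addrA subrK subrr.
Qed.

Lemma alt_iter_scale (s t : V -> V) (hf hg : V -> V) (a : K) n (w : V) :
  (forall x y, hf (x *: y) = x *: hf y) -> (forall x y, hg (x *: y) = x *: hg y) ->
  (forall x, s x = a *: hf x) -> (forall x, t x = a *: hg x) ->
  alt_iter s t n w = a ^+ n *: alt_iter hf hg n w.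
Proof.
elim: n s t hf hg => [|n IH] s t hf hg Zf Zg sE tE; first by rewrite scale1r.
by rewrite /= sE (IH t s hg hf) // Zf scalerA exprS.
Qed.

(** Since [s = - v (f - v)], an alternating product of length [n] is [(- v) ^+ n] times the one in
    [f - v] and [g - v], to which [cheb_iter_diff] applies. *)
Lemma alt_iter_cheb (f g : 'End(V)) (s t : V -> V) n (w : V) : v != 0 ->
  (forall x, f (f x) = d *: f x) -> (forall x, g (g x) = d *: g x) ->
  (forall x, s x = v ^+ 2 *: x - v *: f x) ->
  (forall x, t x = v ^+ 2 *: x - v *: g x) ->
  alt_iter s t n w = alt_iter t s n w <-> cheb_iter f g n w = cheb_iter g f n w.
Proof.
move=> v0 ff gg sE tE.
pose h (k : 'End(V)) x := k x - v *: x.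
have hE (k : 'End(V)) x : k x = h k x + v *: x by rewrite /h subrK.
have hZ (k : 'End(V)) a x : h k (a *: x) = a *: h k x.
  by rewrite /h linearZ scalerBr !scalerA [v * a]mulrC.
have aE : alt_iter s t n w = (- v) ^+ n *: alt_iter (h f) (h g) n w.
  apply: alt_iter_scale => // x; rewrite ?sE ?tE /h scalerBr scalerA mulNr -expr2;
  by rewrite !scaleNr opprK addrC.
have bE : alt_iter t s n w = (- v) ^+ n *: alt_iter (h g) (h f) n w.
  apply: alt_iter_scale => // x; rewrite ?sE ?tE /h scalerBr scalerA mulNr -expr2;
  by rewrite !scaleNr opprK addrC.
have vn0 : (- v) ^+ n != 0 by rewrite expf_neq0 ?oppr_eq0.
rewrite aE bE; have := cheb_iter_diff n w ff gg (hE f) (hE g).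
split=> [/(scalerI vn0) e|e]; apply/eqP; rewrite -subr_eq0.
  by rewrite H e subrr.
by rewrite -scalerBr -H e subrr scaler0.
Qed.

End ChebIter.

Definition bipartite_cheb (K : fieldType) (V W1 W2 : vectType K)
    (i1 : 'Hom(W1, V)) (k1 : 'Hom(V, W1)) (i2 : 'Hom(W2, V)) (k2 : 'Hom(V, W2))
    n w :=
  i1 (poly_act (dihedral_poly K n) (k1 \o i2 \o k2 \o i1)%VF
        (if odd n then k1 w else k1 (i2 (k2 w)))).

(** Moving [k1 \o i2] past a polynomial in the round trip on [W2] yields one in the round trip on
    [W1]. When the inner word has even length, its tail completes one more round trip: this is the
    factor ['X] in the recursion of [dihedral_poly]. *)
Lemma cheb_iter_factor (K : fieldType) (V W1 W2 : vectType K)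
  (i1 : 'Hom(W1, V)) (k1 : 'Hom(V, W1)) (i2 : 'Hom(W2, V)) (k2 : 'Hom(V, W2)) n (w : V) :
  cheb_iter (i1 \o k1)%VF (i2 \o k2)%VF n w = bipartite_cheb i1 k1 i2 k2 n w.
Proof.
suff: cheb_iter (i1 \o k1)%VF (i2 \o k2)%VF n w = bipartite_cheb i1 k1 i2 k2 n w /\
  cheb_iter (i1 \o k1)%VF (i2 \o k2)%VF n.+1 w = bipartite_cheb i1 k1 i2 k2 n.+1 w by case.
elim: n W1 W2 i1 k1 i2 k2 => [|n IH] W1 W2 i1 k1 i2 k2.
  split; rewrite /= /bipartite_cheb /dihedral_poly ?poly_act0 ?linear0 //.
  by rewrite poly_act1 comp_lfunE.
split; first by case: (IH _ _ i1 k1 i2 k2).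
rewrite cheb_iterSS; case: (IH _ _ i1 k1 i2 k2) => -> _; case: (IH _ _ i2 k2 i1 k1) => _ ->.
rewrite /bipartite_cheb dihedral_polySS poly_actB linearB /=; congr (_ - _).
  rewrite comp_lfunE; congr (i1 _); rewrite negbK.
  rewrite -comp_lfunE (poly_act_intertwine (f' := (k1 \o i2 \o k2 \o i1)%VF)); last first.
    by move=> x; rewrite !comp_lfunE.
  rewrite comp_lfunE; case: (odd n) => //=.
  by rewrite mulrC poly_actM -['X]mulr1 poly_actXM poly_act1 !comp_lfunE.
by rewrite negbK.
Qed.

(** * The braid relation for a pair of retracts *)

Definition roots_poly (K : fieldType) (s : seq K) : {poly K} :=
  \prod_(x <- s) ('X - x%:P).

(** The braid relation at [w] with common scalars cancelled; [e] is the parity of the length. *)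
Definition pair_braid (K : fieldType) (V W1 W2 : vectType K)
    (i1 : 'Hom(W1, V)) (p1 : 'Hom(V, W1)) (i2 : 'Hom(W2, V)) (p2 : 'Hom(V, W2))
    (a : 'Hom(W1, W2)) (b : 'Hom(W2, W1)) (s : seq K) (e : bool) (w : V) : Prop :=
  if e then i1 (poly_act (roots_poly s) (b \o a)%VF (p1 w))
            = i2 (poly_act (roots_poly s) (a \o b)%VF (p2 w))
  else i1 (poly_act (roots_poly s) (b \o a)%VF (b (p2 w)))
       = i2 (poly_act (roots_poly s) (a \o b)%VF (a (p1 w))).

Lemma pair_braidC (K : fieldType) (V W1 W2 : vectType K)
    (i1 : 'Hom(W1, V)) (p1 : 'Hom(V, W1)) (i2 : 'Hom(W2, V)) (p2 : 'Hom(V, W2))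
    (a : 'Hom(W1, W2)) (b : 'Hom(W2, W1)) s e w :
  pair_braid i1 p1 i2 p2 a b s e w <-> pair_braid i2 p2 i1 p1 b a s e w.
Proof. by rewrite /pair_braid; case: e; split=> ->. Qed.

Lemma roots_poly_eq0 (K : fieldType) (s : seq K) x :
  ((roots_poly s).[x] == 0) = (x \in s).
Proof. by rewrite -/(root _ x) root_prod_XsubC. Qed.

Section PairBraid.
Variables (K : fieldType) (V W1 W2 : vectType K).
Variables (i1 : 'Hom(W1, V)) (p1 : 'Hom(V, W1)) (i2 : 'Hom(W2, V)) (p2 : 'Hom(V, W2)).
Variables (a : 'Hom(W1, W2)) (b : 'Hom(W2, W1)) (s : seq K) (e : bool).
Hypothesis p1K : forall x, p1 (i1 x) = x.
Hypothesis p2K : forall x, p2 (i2 x) = x.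
Hypothesis aE : forall x, a x = p2 (i1 x).
Hypothesis bE : forall x, b x = p1 (i2 x).
Let S := roots_poly s.
Let S1 := poly_act S (b \o a)%VF.
Let S2 := poly_act S (a \o b)%VF.


Let aS x : a (S1 x) = S2 (a x).
Proof. by apply: poly_act_intertwine => y; rewrite !comp_lfunE. Qed.
Let bS x : b (S2 x) = S1 (b x).
Proof. by apply: poly_act_intertwine => y; rewrite !comp_lfunE. Qed.

Lemma pair_braid_odd w :
  e -> pair_braid i1 p1 i2 p2 a b s e w <-> i1 (S1 (p1 w)) = i2 (S2 (p2 w)).
Proof. by rewrite /pair_braid => ->. Qed.

Lemma pair_braid_even w :
  ~~ e -> pair_braid i1 p1 i2 p2 a b s e w <-> i1 (S1 (b (p2 w))) = i2 (S2 (a (p1 w))).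
Proof. by rewrite /pair_braid => /negPf ->. Qed.

Lemma pair_braid_linear k x y :
  pair_braid i1 p1 i2 p2 a b s e x -> pair_braid i1 p1 i2 p2 a b s e y ->
  pair_braid i1 p1 i2 p2 a b s e (k *: x + y).
Proof.
pose F := (i1 \o (S1 \o (if e then p1 else b \o p2)))%VF.
pose G := (i2 \o (S2 \o (if e then p2 else a \o p1)))%VF.
suff FG w : pair_braid i1 p1 i2 p2 a b s e w <-> F w = G w.
  by move=> /FG Fx /FG Fy; apply/FG; rewrite !linearP /= Fx Fy.
by rewrite /pair_braid /F /G; case: e; rewrite !comp_lfunE.
Qed.

Section Forward.
Hypothesis braid : forall w, pair_braid i1 p1 i2 p2 a b s e w.

Let spectrum := if e then 1 :: s else [:: 0, 1 & s].

(** Put [f = b \o a]. For [e] true, retracting the relation at [i1 x] by [p1] gives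
    [(f - 1) S(f) x = 0]. Otherwise retracting by [p2] and applying [b] gives
    [f (f - 1) S(f) x = 0], whence the extra root [0]. *)
Lemma pair_braid_annul x : poly_act (roots_poly spectrum) (b \o a)%VF x = 0.
Proof.
rewrite /spectrum /roots_poly; have [eo|ee] := boolP e.
  rewrite big_cons poly_actM poly_actXC scale1r -/(roots_poly s) -/S -/S1.
  have /pair_braid_odd - /(_ eo) := braid (i1 x).
  rewrite p1K -aE -aS => /(congr1 p1); rewrite p1K -bE comp_lfunE => <-.
  by rewrite subrr.
rewrite !big_cons poly_actM poly_actXC scale0r subr0 poly_actM poly_actXC scale1r.
rewrite -/(roots_poly s) -/S -/S1.
have /pair_braid_even - /(_ ee) := braid (i1 x).
rewrite p1K -aE -aS -bS -aS => /(congr1 p2); rewrite p2K -aE => /(congr1 b) e1.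
by rewrite linearB /= !comp_lfunE e1 subrr.
Qed.

(** At eigenvalue [1] both polynomials act as the scalar [S.[1]], which is non-zero and cancels from
    the relation. *)
Lemma pair_braid_fixed x : 1 \notin s -> b (a x) = x -> i1 x = i2 (a x).
Proof.
rewrite -roots_poly_eq0 => rho bax.
have S1x : S1 x = S.[1] *: x.
  by apply: poly_act_eigen; rewrite comp_lfunE scale1r.
have S2x : S2 (a x) = S.[1] *: a x.
  by apply: poly_act_eigen; rewrite comp_lfunE bax scale1r.
apply: (scalerI rho).
have [eo|ee] : e \/ ~~ e by case: (e); [left | right].
  have /pair_braid_odd - /(_ eo) := braid (i1 x).
  by rewrite p1K -aE S1x S2x !linearZ.
have /pair_braid_even - /(_ ee) := braid (i1 x).
by rewrite p1K -aE bax S1x S2x !linearZ.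
Qed.

(** Modulo the image of [1 - a b], [S2] acts as the non-zero scalar [S.[1]], so it is enough that
    [S2 u] lies in this image. *)
Lemma pair_braid_image w : 1 \notin s ->
  exists y, p2 w - a (p1 w) = y - a (b y).
Proof.
rewrite -roots_poly_eq0 => rho; set u := p2 w - _.
have [T ST] : exists T, S = T * ('X - 1%:P) + (S.[1])%:P.
  have /factor_theorem[T ST] : root (S - (S.[1])%:P) 1.
    by rewrite rootE !hornerE subrr.
  by exists T; rewrite -ST subrK.
(* Retracting the relation by [p2] gives [S2 u = 0] for odd length and
   [S2 u = (1 - a b) (S2 (p2 w))] for even length. *)
have [y Sy] : exists y, S2 u = y - a (b y).
  have [eo|ee] : e \/ ~~ e by case: (e); [left | right].
    exists 0; rewrite !linear0 addr0 /S2 /u linearB /= -/S2.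
    have /pair_braid_odd - /(_ eo) /(congr1 p2) := braid w.
    by rewrite p2K -aE aS => ->; rewrite subrr.
  have /pair_braid_even - /(_ ee) /(congr1 p2) := braid w.
  rewrite p2K -aE aS => Sw; exists (S2 (p2 w)).
  by rewrite bS aS /u linearB /= -/S2 -Sw.
have -> : u = S.[1]^-1 *: (S.[1] *: u) by rewrite scalerA mulVf // scale1r.
(* The decomposition of [S] turns [S.[1] *: u] into [S2 u + (1 - a b) (T u)], with [T] evaluated at
   [a \o b]. *)
exists (S.[1]^-1 *: (y + poly_act T (a \o b)%VF u)).
have abZ x z : a (b (x *: z)) = x *: a (b z) by rewrite linearZ /= linearZ.
rewrite abZ -scalerBr; congr (_ *: _).
set t := poly_act T (a \o b)%VF.
have Su : S2 u = t (a (b u)) - t u + S.[1] *: u.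
  by rewrite /S2 {1}ST poly_actD poly_actM poly_actXC scale1r poly_actC comp_lfunE linearB.
have abt : a (b (t u)) = t (a (b u)).
  rewrite -(comp_lfunE a b (t u)) -(comp_lfunE a b u).
  exact: poly_act_intertwine.
have abD z z' : a (b (z + z')) = a (b z) + a (b z') by rewrite linearD /= linearD.
rewrite abD abt opprD addrACA -Sy Su.
by rewrite addrAC -[t u - _]opprB subrr add0r.
Qed.

Lemma pair_braid_diagonalizable : uniq s -> 1 \notin s -> (~~ e -> 0 \notin s) ->
  diagonalizable_end (b \o a)%VF.
Proof.
move=> us s1 s0; apply: (@diagonalizable_end_roots _ _ _ spectrum); last first.
  exact: pair_braid_annul.
rewrite /spectrum; case: ifP s0 => _ /= s0; first by rewrite s1.
by rewrite inE eq_sym oner_eq0 s0 // s1.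
Qed.

Lemma pair_braid_eigenvalue l : passmx.leigenvalue (b \o a)%VF l ->
  [\/ l = 1, l \in s | ~~ e /\ l = 0].
Proof.
move=> /(leigenvalue_root pair_braid_annul) /eqP; rewrite roots_poly_eq0.
rewrite /spectrum; case: ifP => _; rewrite !inE.
  by case/orP=> [/eqP|]; [constructor 1 | constructor 2].
by case/or3P=> [/eqP|/eqP|]; [constructor 3 | constructor 1 | constructor 2].
Qed.

(** Here [a x] is a null vector of [a \o b], and the relation at [i1 x] retracts to [S.[0] *: a x =
    0]. *)
Lemma pair_braid_ker x : 0 \notin s -> ~~ e -> b (a x) = 0 -> a x = 0.
Proof.
rewrite -roots_poly_eq0 => s0 ee bax.
have S2x : S2 (a x) = S.[0] *: a x.
  by apply: poly_act_eigen; rewrite comp_lfunE bax linear0 scale0r.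
have /pair_braid_even - /(_ ee) /(congr1 p2) := braid (i1 x).
rewrite p1K -!aE bax p2K S2x /S1 linear0 linear0 => /esym/eqP.
by rewrite scaler_eq0 (negPf s0) => /eqP.
Qed.

End Forward.

Section Converse.
Hypothesis diag1 : diagonalizable_end (b \o a)%VF.
Hypothesis diag2 : diagonalizable_end (a \o b)%VF.
Hypothesis eig1 : forall l, passmx.leigenvalue (b \o a)%VF l ->
  [\/ l = 1, l \in s | ~~ e /\ l = 0].
Hypothesis eig2 : forall l, passmx.leigenvalue (a \o b)%VF l ->
  [\/ l = 1, l \in s | ~~ e /\ l = 0].
Hypothesis ker1 : ~~ e -> forall x, b (a x) = 0 -> a x = 0.
Hypothesis ker2 : ~~ e -> forall y, a (b y) = 0 -> b y = 0.
Hypothesis fixed1 : forall x, b (a x) = x -> i1 x = i2 (a x).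


(** On an eigenvector of [b \o a], the two sides agree by [fixed1] for eigenvalue [1], both vanish
    for a root in [s], and both vanish for [0] because [ker1] gives [a x = 0]. *)
Lemma pair_braid_on1 x : pair_braid i1 p1 i2 p2 a b s e (i1 x).
Proof.
move: x; apply: (diagonalizable_end_ind diag1) => [|k x y|l x].
- by rewrite /pair_braid !linear0; case: e.
- by rewrite linearP; apply: pair_braid_linear.
move=> l_eig /[dup] fx; rewrite comp_lfunE => bax.
have S1x : S1 x = S.[l] *: x by apply: poly_act_eigen.
have S2x : S2 (a x) = S.[l] *: a x by rewrite -aS S1x linearZ.
have fixed_or : l = 1 /\ i1 x = i2 (a x) \/ S.[l] = 0 \/ ~~ e /\ l = 0.
  case: (eig1 l_eig) => [l1|ls|]; [left | right; left | by right; right].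
    by split=> //; apply: fixed1; rewrite bax l1 scale1r.
  by apply/eqP; rewrite roots_poly_eq0.
have [eo|ee] : e \/ ~~ e by case: (e); [left | right].
  apply: (iffRL (pair_braid_odd _ eo)); rewrite p1K -aE S1x S2x !linearZ /=.
  by case: fixed_or => [[_ <-//]|[->|[]]]; rewrite ?scale0r // eo.
apply: (iffRL (pair_braid_even _ ee)); rewrite p1K -aE bax S2x.
have -> : S1 (l *: x) = l *: (S.[l] *: x) by rewrite linearZ /= S1x.
rewrite !linearZ /=.
case: fixed_or => [[-> <-]|[->|[_ l0]]]; first by rewrite scale1r.
  by rewrite !scale0r scaler0.
by rewrite l0 scale0r (ker1 ee) ?bax ?l0 ?scale0r // !linear0 // scaler0.
Qed.

(** For odd length, [S.[l] * (1 - l)] vanishes at every eigenvalue [l] of [a \o b]. *)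
Let S2_fixed y : e -> S2 (y - a (b y)) = 0.
Proof.
pose F := (S2 \o (\1 - (a \o b)))%VF.
have FE z : S2 (z - a (b z)) = F z.
  by rewrite comp_lfunE add_lfunE opp_lfunE id_lfunE comp_lfunE.
move=> eo; move: y; apply: (diagonalizable_end_ind diag2) => [|k x y|l x].
- by rewrite FE linear0.
- by rewrite !FE linearP /= => -> ->; rewrite scaler0 addr0.
move=> l_eig /[dup] fx; rewrite comp_lfunE => ->.
have S2x : S2 x = S.[l] *: x by apply: poly_act_eigen.
rewrite /S2 linearB linearZ /= -/S2 S2x.
case: (eig2 l_eig) => [->|ls|[]]; last by rewrite eo.
  by rewrite scale1r subrr.
by move: ls; rewrite -roots_poly_eq0 => /eqP ->; rewrite scale0r scaler0 subrr.
Qed.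

(** For even length the eigenvalue [0] may also occur; by [ker2], [b] kills its eigenvectors. *)
Let bS2_fixed y : ~~ e -> b (S2 (y - a (b y))) = 0.
Proof.
pose F := (b \o (S2 \o (\1 - (a \o b))))%VF.
have FE z : b (S2 (z - a (b z))) = F z.
  by rewrite 2!comp_lfunE add_lfunE opp_lfunE id_lfunE comp_lfunE.
move=> ee; move: y; apply: (diagonalizable_end_ind diag2) => [|k x y|l x].
- by rewrite FE linear0.
- by rewrite !FE linearP /= => -> ->; rewrite scaler0 addr0.
move=> l_eig /[dup] fx; rewrite comp_lfunE => abx.
have S2x : S2 x = S.[l] *: x by apply: poly_act_eigen.
rewrite abx /S2 linearB linearZ /= -/S2 S2x.
case: (eig2 l_eig) => [->|ls|[_ l0]].
- by rewrite scale1r subrr linear0.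
- by move: ls; rewrite -roots_poly_eq0 => /eqP ->; rewrite scale0r scaler0 subrr linear0.
by rewrite l0 scale0r subr0 linearZ /= (ker2 ee) ?scaler0 // abx l0 scale0r.
Qed.

(** The difference of [p2 w] and [a (p1 w)] is killed by [S2], or by [b] after [S2], so the relation
    at [w] is the one at [i1 (p1 w)]. *)
Lemma pair_braid_off w : (exists y, p2 w - a (p1 w) = y - a (b y)) ->
  pair_braid i1 p1 i2 p2 a b s e w.
Proof.
case=> y /eqP; rewrite subr_eq => /eqP p2w; have := pair_braid_on1 (p1 w).
have [eo|ee] : e \/ ~~ e by case: (e); [left | right].
  move/(iffLR (pair_braid_odd _ eo)) => E; apply: (iffRL (pair_braid_odd _ eo)).
  rewrite p1K -aE in E; rewrite p2w /S2 linearD /= -/S2 S2_fixed // add0r.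
  exact: E.
move/(iffLR (pair_braid_even _ ee)) => E; apply: (iffRL (pair_braid_even _ ee)).
rewrite p1K -aE in E; rewrite p2w -E -bS /S2 linearD /= -/S2 linearD /=.
by rewrite bS2_fixed // add0r bS.
Qed.

End Converse.
End PairBraid.

(** * Hecke representations by generators and relations *)

Section FreeAction.
Variables (K : fieldType) (I : finType) (V : vectType K) (t : I -> 'End(V)).
Local Notation free := {malg K[{fmonom I}]}.

Definition word_act (s : seq I) : 'End(V) :=
  foldr (fun i f => t i \o f)%VF \1%VF s.

Definition free_act (a : free) : 'End(V) :=
  \sum_(k <- msupp a) a@_k *: word_act k.

Lemma word_act_cat s1 s2 : word_act (s1 ++ s2) = (word_act s1 \o word_act s2)%VF.
Proof. by elim: s1 => [|i s1 IH] /=; rewrite ?comp_lfun1l // IH comp_lfunA. Qed.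

Let free_act_wide (d : {fset {fmonom I}}) (a : free) : (msupp a `<=` d)%fset ->
  free_act a = \sum_(k <- d) a@_k *: word_act k.
Proof.
move=> le; rewrite [LHS](big_fset_incl _ le) => //= x xd /mcoeff_outdom ->.
by rewrite scale0r.
Qed.

Fact free_act_linear : linear free_act.
Proof.
move=> c a b.
pose d := (msupp a `|` msupp b `|` msupp (c *: a + b))%fset.
rewrite !(@free_act_wide d).
- rewrite scaler_sumr -big_split; apply: eq_bigr => k _.
  by rewrite mcoeffD mcoeffZ scalerDl scalerA.
- by rewrite /d -fsetUA finmap.fsetUCA finmap.fsubsetUl.
- by rewrite /d -fsetUA finmap.fsubsetUl.
- by rewrite finmap.fsubsetUr.
Qed.

HB.instance Definition _ :=
  GRing.isLinear.Build K free 'End(V) _ free_act free_act_linear.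

Lemma free_actU c (k : {fmonom I}) : free_act << c *g k >> = c *: word_act k.
Proof. by rewrite (free_act_wide msuppU_le) big_seq_fset1 mcoeffUU. Qed.

Lemma free_act_gen i : free_act (free_gen K i) = t i.
Proof. by rewrite free_actU scale1r fmU /= comp_lfun1r. Qed.

Lemma free_act1 : free_act 1 = \1%VF.
Proof. by rewrite free_actU scale1r fm1. Qed.

Lemma free_actE a w : free_act a w = \sum_(k <- msupp a) a@_k *: word_act k w.
Proof. by rewrite sum_lfunE; apply: eq_bigr => k _; rewrite scale_lfunE. Qed.

Lemma free_actM a b : free_act (a * b) = (free_act a \o free_act b)%VF.
Proof.
rewrite malgME linear_sum /=; apply/lfunP => w; rewrite comp_lfunE (free_actE a) sum_lfunE.
apply: eq_bigr => k _; rewrite linear_sum /= sum_lfunE (free_actE b) linear_sum scaler_sumr.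
apply: eq_bigr => l _; rewrite free_actU scale_lfunE linearZ /= scalerA.
by rewrite fmM word_act_cat comp_lfunE.
Qed.

Lemma free_act_alternating i j n w :
  free_act (alternating (free_gen K i) (free_gen K j) n) w = alt_iter (t i) (t j) n w.
Proof.
elim: n i j => [|n IH] i j /=; first by rewrite free_act1 id_lfunE.
by rewrite free_actM free_act_gen comp_lfunE IH.
Qed.

Lemma free_act_sign (phi : 'Hom(V, K^o)) a w :
  (forall i x, phi (t i x) = - phi x) -> phi w = 0 -> phi (free_act a w) = 0.
Proof.
move=> phit phiw; rewrite free_actE linear_sum big1 // => k _.
rewrite linearZ /=; elim: (k : seq I) => [|i s IH] /=.
  by rewrite id_lfunE phiw scaler0.
by rewrite comp_lfunE phit scalerN IH oppr0.
Qed.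

End FreeAction.

Definition hecke_relations (I : finType) (m : I -> I -> nat) (K : fieldType) (q : K)
    (V : vectType K) (t : I -> 'End(V)) : Prop :=
  (forall i j, i != j -> forall w,
     alt_iter (t i) (t j) (m i j) w = alt_iter (t j) (t i) (m i j) w) /\
  (forall i w, t i (t i w + w) = q *: (t i w + w)).

Section HeckeAction.
Variables (I : finType) (m : I -> I -> nat) (K : fieldType) (q : K).
Variables (V : vectType K) (t : I -> 'End(V)).
Local Notation H := (hecke_algebra m q).

Lemma defines_hecke_relations :
  defines_hecke_representation m q t -> hecke_relations m q t.
Proof.
case=> rho [[rho_lin rho1 rhoM] rhot].
have proj_eq a b : a - b \in hecke_ideal m q -> hecke_proj m q a = hecke_proj m q b.
  by rewrite -hecke_proj_eq0 linearB subr_eq0 => /eqP.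
have relI r : hecke_relator m q r -> r \in hecke_ideal m q.
  by move=> rr; apply/asboolP => J _; apply.
have rho_alt i j n w : rho (hecke_proj m q (alternating (free_gen K i) (free_gen K j) n)) w
    = alt_iter (t i) (t j) n w.
  elim: n i j => [|n IH] i j /=; first by rewrite rmorph1 rho1 id_lfunE.
  by rewrite rmorphM rhoM comp_lfunE IH -/(hecke_gen m q i) rhot.
split=> [i j ij w|i w].
  by rewrite -!rho_alt; congr (rho _ w); apply/proj_eq/relI/BraidRelator.
have rhoD x y : rho (x + y) = rho x + rho y by rewrite -[x]scale1r rho_lin !scale1r.
have rhoZ c x : rho (c *: x) = c *: rho x.
  have rho0 : rho 0 = 0 by apply: (addrI (rho 0)); rewrite -rhoD !addr0.
  by rewrite -[c *: x]addr0 rho_lin rho0 addr0.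
have rho_t1 : rho (hecke_proj m q (free_gen K i + 1)) w = t i w + w.
  by rewrite rmorphD rmorph1 rhoD rho1 add_lfunE id_lfunE -/(hecke_gen m q i) rhot.
have : hecke_proj m q (free_gen K i * (free_gen K i + 1))
       = hecke_proj m q (q *: (free_gen K i + 1)).
  apply/proj_eq/relI; rewrite -mulr_algl -mulrBl; exact: QuadraticRelator.
rewrite rmorphM linearZ => /(congr1 (fun x => rho x w)).
by rewrite rhoM rhoZ scale_lfunE comp_lfunE rho_t1 -/(hecke_gen m q i) rhot.
Qed.

Section FromRelations.
Hypothesis t_rel : hecke_relations m q t.

Let free_act_ideal a : a \in hecke_ideal m q -> free_act t a = 0.
Proof.
move=> /asboolP aJ; apply: (aJ (fun x => free_act t x = 0)) => {aJ}.
  split=> [|x y xJ yJ|u x w xJ]; first by rewrite linear0.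
    by rewrite linearB /= xJ yJ subrr.
  by rewrite !free_actM xJ comp_lfun0r comp_lfun0l.
case: t_rel => braid quad r [i j ij|i]; apply/lfunP => w.
  rewrite linearB /= add_lfunE opp_lfunE !free_act_alternating braid //.
  by rewrite subrr zero_lfunE.
rewrite mulrBl mulr_algl linearB linearZ /= free_actM linearD /= free_act_gen free_act1.
by rewrite add_lfunE opp_lfunE comp_lfunE scale_lfunE add_lfunE id_lfunE quad subrr zero_lfunE.
Qed.

Definition hecke_act (h : H) : 'End(V) := free_act t (repr h).

Lemma hecke_act_proj a : hecke_act (hecke_proj m q a) = free_act t a.
Proof.
apply/eqP; rewrite -subr_eq0 -linearB; apply/eqP/free_act_ideal.
by rewrite -hecke_proj_eq0 linearB /= subr_eq0 /hecke_proj reprK.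
Qed.

Lemma hecke_act_representation : representation hecke_act.
Proof.
split=> [c x y||x y].
- have [a ->] := hecke_proj_surj x; have [b ->] := hecke_proj_surj y.
  by rewrite -linearP !hecke_act_proj linearP.
- by rewrite -(rmorph1 (hecke_proj m q)) hecke_act_proj free_act1.
have [a ->] := hecke_proj_surj x; have [b ->] := hecke_proj_surj y.
by rewrite -rmorphM !hecke_act_proj free_actM.
Qed.

Lemma hecke_act_gen i : hecke_act (hecke_gen m q i) = t i.
Proof. by rewrite hecke_act_proj free_act_gen. Qed.

(* A quotient isomorphic to the sign character lifts to a submodule. *)
Lemma semisimple_sign_vector (phi : 'Hom(V, K^o)) u :
  semisimple H -> (forall i x, phi (t i x) = - phi x) -> phi u != 0 ->
  exists2 w, phi w != 0 & forall i, t i w = - w.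
Proof.
move=> ss phit phiu.
have [rho_lin rho1 rhoM] := hecke_act_representation.
have rhoD x y w : hecke_act (x + y) w = hecke_act x w + hecke_act y w.
  by rewrite -[x]scale1r rho_lin !scale1r add_lfunE.
have rho0 w : hecke_act 0 w = 0.
  by apply: (addrI (hecke_act 0 w)); rewrite -rhoD !addr0.
(* This left ideal is the kernel of the map onto the sign character defined by [phi] and [u]; the
   component [z] of [1] in a complement supplies the vector. *)
have [|L' [[L'0 L'D L'M] L'I L'C]] := ss (fun h => phi (hecke_act h u) = 0).
  split=> [|x y xL yL|x y yL]; first by rewrite rho0 linear0.
    by rewrite rhoD linearD /= xL yL addr0.
  rewrite rhoM comp_lfunE; have [a ->] := hecke_proj_surj x.
  by rewrite hecke_act_proj free_act_sign.
have [y [z [yL zL' yz]]] := L'C 1.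
have uE : hecke_act y u + hecke_act z u = u by rewrite -rhoD -yz rho1 id_lfunE.
exists (hecke_act z u); first by rewrite -uE linearD /= yL add0r in phiu.
move=> i; apply/eqP; rewrite -addr_eq0 -hecke_act_gen -comp_lfunE -rhoM -rhoD.
(* This element lies in [L'] and, because [t i] changes the sign of [phi], also in the left
   ideal. *)
suff -> : hecke_gen m q i * z + z = 0 by rewrite rho0.
apply: L'I; last by apply: L'D => //; apply: L'M.
by rewrite rhoD rhoM comp_lfunE hecke_act_gen linearD /= phit addNr.
Qed.

End FromRelations.

Lemma defines_hecke_representationP :
  defines_hecke_representation m q t <-> hecke_relations m q t.
Proof.
split=> [|t_rel]; first exact: defines_hecke_relations.
by exists (hecke_act); split=> [|i]; [apply: hecke_act_representation | apply: hecke_act_gen].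
Qed.

End HeckeAction.

(** * From operators to the relation between retracts *)

(** With [c = (v + v^-1) ^+ 2 = q + q^-1 + 2] this converts the roots [4 cos^2 (a pi / m)] into the
    numbers [lambda]. *)
Lemma poly_act_roots_scale (K : fieldType) (V : vectType K) (s : seq K) (c : K)
    (f : 'End(V)) w : c != 0 ->
  poly_act (roots_poly s) (c *: f) w
  = c ^+ size s *: poly_act (roots_poly [seq x / c | x <- s]) f w.
Proof.
move=> c0; rewrite /roots_poly; elim: s => [|x s IH].
  by rewrite !big_nil !poly_act1 scale1r.
rewrite /= !big_cons !poly_actM !poly_actXC IH linearZ /= scale_lfunE.
by rewrite scalerBr !scalerA exprSr [x * _]mulrC -[_ * c * _]mulrA [c * (x / c)]mulrCA divff ?mulr1.
Qed.

(** Attaching [d] to the projections gives operators that act as [d] on their images, as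
    [alt_iter_cheb] requires. Each round trip then carries [d ^+ 2], and the remaining scalar is the
    same on both sides. *)
Lemma alt_iter_pair_braid (K : fieldType) (V W1 W2 : vectType K) (v d : K)
    (i1 : 'Hom(W1, V)) (p1 : 'Hom(V, W1)) (i2 : 'Hom(W2, V)) (p2 : 'Hom(V, W2))
    (a : 'Hom(W1, W2)) (b : 'Hom(W2, W1)) (t1 t2 : V -> V) s m w :
  v != 0 -> d != 0 -> v * d = v ^+ 2 + 1 ->
  (forall x, p1 (i1 x) = x) -> (forall x, p2 (i2 x) = x) ->
  (forall x, a x = p2 (i1 x)) -> (forall x, b x = p1 (i2 x)) ->
  (forall x, t1 x = v ^+ 2 *: x - (v * d) *: i1 (p1 x)) ->
  (forall x, t2 x = v ^+ 2 *: x - (v * d) *: i2 (p2 x)) ->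
  dihedral_poly K m = roots_poly s ->
  alt_iter t1 t2 m w = alt_iter t2 t1 m w <->
  pair_braid i1 p1 i2 p2 a b [seq x / d ^+ 2 | x <- s] (odd m) w.
Proof.
move=> v0 d0 vd p1K p2K aE bE t1E t2E ms.
pose k1 := d *: p1; pose k2 := d *: p2.
have ik1E x : (i1 \o k1)%VF x = d *: i1 (p1 x).
  by rewrite comp_lfunE scale_lfunE linearZ.
have ik2E x : (i2 \o k2)%VF x = d *: i2 (p2 x).
  by rewrite comp_lfunE scale_lfunE linearZ.
have [||||ltr rtl] := @alt_iter_cheb K V v d vd (i1 \o k1)%VF (i2 \o k2)%VF t1 t2 m w v0.
- by move=> x; rewrite !ik1E !linearZ /= p1K.
- by move=> x; rewrite !ik2E !linearZ /= p2K.
- by move=> x; rewrite ik1E scalerA.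
- by move=> x; rewrite ik2E scalerA.
have d20 : d ^+ 2 != 0 by rewrite expf_neq0.
have M1 : (k1 \o i2 \o k2 \o i1)%VF = d ^+ 2 *: (b \o a)%VF.
  apply/lfunP => x; rewrite !comp_lfunE !scale_lfunE comp_lfunE linearZ /= linearZ /=.
  by rewrite scalerA aE bE.
have M2 : (k2 \o i1 \o k1 \o i2)%VF = d ^+ 2 *: (a \o b)%VF.
  apply/lfunP => x; rewrite !comp_lfunE !scale_lfunE comp_lfunE linearZ /= linearZ /=.
  by rewrite scalerA aE bE.
set s' := map _ s; pose e := d ^+ 2 ^+ size s.
have B1 : bipartite_cheb i1 k1 i2 k2 m w = (e * (if odd m then d else d ^+ 2)) *:
    (if odd m then i1 (poly_act (roots_poly s') (b \o a)%VF (p1 w))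
     else i1 (poly_act (roots_poly s') (b \o a)%VF (b (p2 w)))).
  rewrite /bipartite_cheb ms M1 poly_act_roots_scale // !linearZ /= -scalerA; congr (_ *: _).
  case: ifP => _; first by rewrite scale_lfunE !linearZ.
  by rewrite !scale_lfunE bE !linearZ /= !scalerA -expr2.
have B2 : bipartite_cheb i2 k2 i1 k1 m w = (e * (if odd m then d else d ^+ 2)) *:
    (if odd m then i2 (poly_act (roots_poly s') (a \o b)%VF (p2 w))
     else i2 (poly_act (roots_poly s') (a \o b)%VF (a (p1 w)))).
  rewrite /bipartite_cheb ms M2 poly_act_roots_scale // !linearZ /= -scalerA; congr (_ *: _).
  case: ifP => _; first by rewrite scale_lfunE !linearZ.
  by rewrite !scale_lfunE aE !linearZ /= !scalerA -expr2.
have e0 : e * (if odd m then d else d ^+ 2) != 0.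
  by rewrite mulf_neq0 ?expf_neq0 //; case: ifP.
have pE : pair_braid i1 p1 i2 p2 a b s' (odd m) w <->
    bipartite_cheb i1 k1 i2 k2 m w = bipartite_cheb i2 k2 i1 k1 m w.
  rewrite B1 B2 /pair_braid; case: (odd m) e0 => e0;
  by split=> [->//|/(scalerI e0)].
rewrite pE -!cheb_iter_factor; split; [exact: ltr | exact: rtl].
Qed.

(** * Consequences of genericity *)

Lemma lfun_of_linear (K : fieldType) (V W : vectType K) (f : V -> W) :
  linear f -> exists F : 'Hom(V, W), F =1 f.
Proof.
move=> lf; pose g : {linear V -> W} := HB.pack f (GRing.isLinear.Build _ _ _ _ f lf).
by exists (linfun g) => x; rewrite lfunE.
Qed.

Section Generic.
Variables (K : fieldType) (v : K) (m : nat).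
Hypothesis v0 : v != 0.
Hypothesis ss : semisimple (hecke_algebra (dihedral_matrix m) (v ^+ 2)).

Let sndl : 'Hom((K^o * K^o)%type, K^o) := linfun snd.

(* If v + v^-1 = 0, i.e. q = -1, both generators may act by the same Jordan block. *)
Lemma generic_quantum2_neq0 : v + v^-1 != 0.
Proof.
apply/eqP => vV.
have q1 : v ^+ 2 = -1.
  by apply/eqP; rewrite -addr_eq0 -[1](mulfV v0) expr2 -mulrDr vV mulr0.
(* At [q = -1] the quadratic relation is [(t + 1) ^+ 2 = 0], which this Jordan block satisfies. *)
have [t tE] : exists t : 'End((K^o * K^o)%type), t =1 fun w => (w.2 - w.1, - w.2).
  apply: lfun_of_linear => c x y; apply: injective_projections => /=.
    by rewrite scalerBr opprD addrACA.
  by rewrite scalerN opprD.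
have rel : hecke_relations (dihedral_matrix m) (v ^+ 2) (fun _ : bool => t).
  split=> // _ w; rewrite q1 !tE scaleN1r /=; apply: injective_projections => /=.
    by rewrite subrK addNr !sub0r.
  by rewrite addNr oppr0.
have [i x||w] := semisimple_sign_vector rel (phi := sndl) (u := (0, 1)) ss.
- by rewrite !lfunE /= tE.
- by rewrite lfunE /= oner_eq0.
rewrite lfunE /= => w2 tw; move: (congr1 fst (tw true)); rewrite tE /= => /eqP.
by rewrite -subr_eq0 opprK subrK (negPf w2).
Qed.

(* If 1 were a root, i1, i2 and p below would define a non-split extension of the
   sign character by the character sigma |-> q. *)
Lemma generic_root_neq1 (s : seq K) : dihedral_poly K m = roots_poly s ->
  1 \notin [seq x / (v + v^-1) ^+ 2 | x <- s].
Proof.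
move=> ms; set d := v + v^-1; have d0 := generic_quantum2_neq0.
have vd : v * d = v ^+ 2 + 1 by rewrite /d mulrDr mulfV // expr2.
apply/negP => s1.
have [p pE] : exists p : 'Hom((K^o * K^o)%type, K^o), p =1 fun w => w.1 + w.2.
  by apply: lfun_of_linear => c x y; rewrite /= scalerDr addrACA.
have [i1 i1E] : exists i1 : 'Hom(K^o, (K^o * K^o)%type), i1 =1 fun x => (x, 0).
  apply: lfun_of_linear => c x y; apply: injective_projections => //=;
  by rewrite scaler0 addr0.
have [i2 i2E] : exists i2 : 'Hom(K^o, (K^o * K^o)%type), i2 =1 fun x => (0, x).
  apply: lfun_of_linear => c x y; apply: injective_projections => //=;
  by rewrite scaler0 addr0.
pose i e := if e then i1 else i2.
have piK e x : p (i e x) = x.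
  by rewrite /i pE; case: e; rewrite ?i1E ?i2E /= ?addr0 ?add0r.
pose t e := v ^+ 2 *: \1%VF - (v * d) *: (i e \o p)%VF.
have tE e w : t e w = v ^+ 2 *: w - (v * d) *: i e (p w).
  by rewrite /t add_lfunE opp_lfunE !scale_lfunE id_lfunE comp_lfunE.
have pt e w : p (t e w) = - p w.
  have pZ c x : p (c *: x) = c *: p x by rewrite linearZ.
  rewrite tE linearB /= !pZ piK.
  by rewrite -scalerBl vd opprD addrA subrr add0r scaleN1r.
have rel : hecke_relations (dihedral_matrix m) (v ^+ 2) t.
  split=> [e1 e2 e12 w|e w]; last first.
    have ptw : p (t e w + w) = 0 by rewrite linearD /= pt addNr.
    by rewrite [LHS]tE ptw linear0 scaler0 subr0.
  have -> : dihedral_matrix m e1 e2 = m by rewrite /dihedral_matrix (negPf e12).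
  apply/(@alt_iter_pair_braid K _ _ _ v d (i e1) p (i e2) p \1%VF \1%VF _ _ s) => //.
  - by move=> x; rewrite id_lfunE piK.
  - by move=> x; rewrite id_lfunE piK.
  (* Both maps between the retracts are the identity, so the polynomial acts by its value at [1],
     which is zero by assumption. *)
  have S0 (z : K^o) : poly_act (roots_poly [seq x / d ^+ 2 | x <- s]) (\1 \o \1)%VF z = 0.
    rewrite (@poly_act_eigen _ _ _ _ _ 1) ?comp_lfunE ?id_lfunE ?scale1r //.
    by move: s1; rewrite -roots_poly_eq0 => /eqP ->; rewrite scale0r.
  by rewrite /pair_braid; case: ifP => _; rewrite !S0 !linear0.
have [||w pw tw] := semisimple_sign_vector rel (phi := p) (u := (1, 0)) ss.
- by [].
- by rewrite pE /= addr0 oner_eq0.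
(* A vector on which [t e] acts as [-1] lies in the image of [i e], and the images of [i1] and [i2]
   meet only in zero. *)
have wi e : w = i e (p w).
  have vd0 : v * d != 0 by rewrite mulf_neq0.
  apply: (scalerI vd0); apply/eqP; rewrite -subr_eq0 {1}vd scalerDl scale1r addrAC.
  by rewrite -tE tw addNr.
have := wi true; rewrite {1}(wi false) /i i1E i2E => /(congr1 fst) /= e.
by rewrite -e eqxx in pw.
Qed.

End Generic.

(** * The operators of a pre W-graph as inclusions and retractions *)

Section FreeSpaceTheory.
Variables (K : fieldType) (T : finType).
Local Notation V := {ffun T -> K^o}.

Lemma ffun_basis (w : V) : w = \sum_x (w x : K) *: basis_vec K x.
Proof.
apply/ffunP => y; rewrite sum_ffunE (bigD1 y) //= !ffunE eqxx.
rewrite big1 ?addr0 => [|x /negPf xy]; first exact/esym/mulr1.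
by rewrite !ffunE eq_sym xy; exact: mulr0.
Qed.

Lemma lfun_basisP (W : vectType K) (f g : 'Hom(V, W)) :
  (forall x, f (basis_vec K x) = g (basis_vec K x)) -> f = g.
Proof.
move=> fg; apply/lfunP => w; rewrite [w]ffun_basis !linear_sum.
by apply: eq_bigr => x _; rewrite !linearZ /= fg.
Qed.

End FreeSpaceTheory.

Section PreWgraph.
Variables (K : fieldType) (I : finType) (v : K) (G : preWgraph K I).
Hypothesis v0 : v != 0.
Local Notation d := (v + v^-1).
Local Notation V := {ffun vertex G -> K^o}.
Local Notation Vbar := (Vbar G).
Local Notation e := (basis_vec K).

Definition label_incl i : 'Hom(Vbar i, V) :=
  linear_extension (fun x : Vbar_index G i => basis_vec K (val x)).

(** This is [d] times a retraction, left undivided so that [tau_quadratic] holds without [d != 0]: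
    genericity says nothing about [d] when [I] has at most one element. *)
Definition label_proj i : 'Hom(V, Vbar i) :=
  linear_extension (fun x : vertex G =>
    if insub x is Some x' then d *: basis_vec K (x' : Vbar_index G i)
    else - \sum_(y : Vbar_index G i | [set val y; x] \in edges G)
             mu i (val y) x *: basis_vec K y).

Lemma label_projK i x : label_proj i (label_incl i x) = d *: x.
Proof.
suff -> : d *: x = (d *: \1%VF : 'End(Vbar i)) x.
  rewrite -comp_lfunE; congr (fun_of_lfun _ _); apply: lfun_basisP => y.
  by rewrite comp_lfunE !linear_extension_basis valK scale_lfunE id_lfunE.
by rewrite scale_lfunE id_lfunE.
Qed.

Lemma tau_label i w :
  tau v G i w = v ^+ 2 *: w - v *: label_incl i (label_proj i w).
Proof.
suff -> : tau v G i = v ^+ 2 *: \1%VF - v *: (label_incl i \o label_proj i)%VF.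
  by rewrite add_lfunE opp_lfunE !scale_lfunE id_lfunE comp_lfunE.
apply: lfun_basisP => x; rewrite add_lfunE opp_lfunE !scale_lfunE id_lfunE comp_lfunE.
rewrite !linear_extension_basis; case: insubP => [x' -> <-|/negPf ->].
  have -> : label_incl i (d *: e x') = d *: e (val x').
    by rewrite linearZ /= linear_extension_basis.
  rewrite scalerA -scalerBl.
  by rewrite mulrDr mulfV // expr2 opprD addrA subrr add0r scaleN1r.
have inclN y : label_incl i (- y) = - label_incl i y by rewrite linearN.
rewrite inclN scalerN opprK; congr (_ + _ *: _).
rewrite linear_sum big_sub_cond; apply: eq_bigr => y _.
by rewrite linearZ /= linear_extension_basis.
Qed.

(** [label_proj] sends [tau w + w] to [v ^+ 2 + 1 - v d], which is zero, times the projection of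
    [w]. *)
Lemma tau_quadratic i w :
  tau v G i (tau v G i w + w) = v ^+ 2 *: (tau v G i w + w).
Proof.
have projD x y : label_proj i (x + y) = label_proj i x + label_proj i y by rewrite linearD.
have projZ c x : label_proj i (c *: x) = c *: label_proj i x by rewrite linearZ.
have proj0 : label_proj i (tau v G i w + w) = 0.
  rewrite projD tau_label -scaleNr projD !projZ label_projK !scalerA.
  rewrite addrAC -[X in _ + X + _]scale1r -!scalerDl mulNr mulrDr mulfV // -expr2.
  by rewrite subrr scale0r.
by rewrite [LHS]tau_label proj0 linear0 scaler0 subr0.
Qed.

Section Normalized.
Hypothesis d0 : d != 0.

Definition label_retract i : 'Hom(V, Vbar i) := d^-1 *: label_proj i.

Lemma label_retractK i x : label_retract i (label_incl i x) = x.
Proof. by rewrite scale_lfunE label_projK scalerA mulVf // scale1r. Qed.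

Lemma tau_retract i w :
  tau v G i w = v ^+ 2 *: w - (v * d) *: label_incl i (label_retract i w).
Proof.
have -> : label_incl i (label_retract i w) = d^-1 *: label_incl i (label_proj i w).
  by rewrite scale_lfunE linearZ.
by rewrite tau_label scalerA mulfK.
Qed.

Lemma Abar_retract j i x : Abar v G j i x = label_retract i (label_incl j x).
Proof.
rewrite -comp_lfunE; congr (fun_of_lfun _ _); apply: lfun_basisP => {}x.
rewrite comp_lfunE scale_lfunE !linear_extension_basis.
case: insubP => [x' _ _|_]; first by rewrite scalerA mulVf // scale1r.
by rewrite scalerN mulN1r scaleNr.
Qed.

Let common i j := <<[seq e x | x in [pred x : Vbar_index G i | val x \in labelled G j]]>>%VS.

Lemma label_incl_coord i (x : Vbar i) (y : Vbar_index G i) : label_incl i x (val y) = x y.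
Proof.
rewrite [x in LHS]ffun_basis linear_sum sum_ffunE /= (bigD1 y) //= linearZ /=.
rewrite linear_extension_basis !ffunE eqxx big1 ?addr0 => [|z zy]; first exact: mulr1.
rewrite linearZ /= linear_extension_basis !ffunE (inj_eq val_inj) eq_sym (negPf zy).
exact: mulr0.
Qed.

Lemma label_incl_off i (x : Vbar i) (y : vertex G) :
  y \notin labelled G i -> label_incl i x y = 0.
Proof.
move=> yi; rewrite [x]ffun_basis linear_sum sum_ffunE big1 //= => z _.
rewrite linearZ /= linear_extension_basis !ffunE.
case: eqP => [yz|_]; first by rewrite yz (valP z) in yi.
exact: mulr0.
Qed.

(** If the inclusions agree, the coordinates of [x] outside [X_j] vanish, since the other side is
    supported on [X_j]. *)
Lemma common_span i j x :
  (x \in common i j) = (label_incl i x == label_incl j (Abar v G i j x)).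
Proof.
apply/idP/eqP => [|xE].
  pose f := (label_incl i - (label_incl j \o Abar v G i j))%VF.
  suff /subvP s : (common i j <= lker f)%VS.
    by move=> /s; rewrite memv_ker add_lfunE opp_lfunE comp_lfunE subr_eq0 => /eqP.
  apply/span_subvP => _ /imageP[y /= yj ->].
  rewrite memv_ker add_lfunE opp_lfunE comp_lfunE subr_eq0 Abar_retract.
  have -> : label_incl i (e y) = label_incl j (e (Sub (val y) yj)).
    by rewrite !linear_extension_basis.
  by rewrite label_retractK.
rewrite [x]ffun_basis; apply: memv_suml => y _.
have [yj|yj] := boolP (val y \in labelled G j).
  by apply/memvZ/memv_span/imageP; exists y.
by rewrite -label_incl_coord xE label_incl_off // scale0r mem0v.
Qed.

Lemma Abar_eigenspaceP i j :
  passmx.leigenspace (Abar v G j i \o Abar v G i j)%VF 1 = common i j <->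
  forall x, Abar v G j i (Abar v G i j x) = x ->
    label_incl i x = label_incl j (Abar v G i j x).
Proof.
have eigP x : (x \in passmx.leigenspace (Abar v G j i \o Abar v G i j)%VF 1) =
   (Abar v G j i (Abar v G i j x) == x).
  by rewrite memv_ker add_lfunE opp_lfunE comp_lfunE scale1r id_lfunE subr_eq0.
split=> [E x ax|E].
  by apply/eqP; rewrite -common_span -E eigP ax.
apply/vspaceP => x; rewrite eigP common_span; apply/eqP/eqP => [/E //|xE].
by rewrite [LHS]Abar_retract -xE label_retractK.
Qed.

End Normalized.
End PreWgraph.

(** * The two implications *)

Section Characterization.
Variables (I : finType) (m : I -> I -> nat) (K : fieldType).
Variables (c : nat -> nat -> K) (v : K) (G : preWgraph K I).
Hypothesis m_coxeter : coxeter_matrix m.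
Hypothesis c_cos : forall i j, i != j -> (2 < m i j)%N -> four_cos_sq (m i j) (c (m i j)).
Hypothesis q_generic : generic m (v ^+ 2).

Local Notation d := (v + v^-1).
Local Notation incl := (label_incl G).
Local Notation retr := (label_retract v G).
Local Notation A := (Abar v G).

Definition lambda_seq n : seq K := [seq lambda (v ^+ 2) c n a | a <- iota 1 n.-1./2].

Let v_neq0 : v != 0.
Proof. by case: q_generic; rewrite expf_eq0. Qed.

(** Genericity constrains [d] only through a pair of distinct indices, so such a pair has to be
    supplied. *)
Let d_neq0 (i j : I) : i != j -> d != 0.
Proof. by case: q_generic => _ ss ij; apply: (generic_quantum2_neq0 v_neq0 (ss i j ij)). Qed.

Let lambda_seqE n : lambda_seq n = [seq x / d ^+ 2 | x <- [seq c n a | a <- iota 1 n.-1./2]].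
Proof.
rewrite -map_comp; apply: eq_map => a; rewrite /= /lambda; congr (_ / _).
by field.
Qed.

Let m_factor (i j : I) : i != j ->
  dihedral_poly K (m i j) = roots_poly [seq c (m i j) a | a <- iota 1 (m i j).-1./2].
Proof.
move=> ij; case: m_coxeter => _ _ m2; apply: dihedral_poly_factor; first exact: m2.
exact: c_cos.
Qed.

Let lambda_seq_neq1 (i j : I) : i != j -> 1 \notin lambda_seq (m i j).
Proof.
move=> ij; rewrite lambda_seqE; case: q_generic => _ ss.
exact: (generic_root_neq1 v_neq0 (ss i j ij) (m_factor ij)).
Qed.

Let m_gt2 (i j : I) a : i != j -> a \in iota 1 (m i j).-1./2 ->
  (2 < m i j)%N && (0 < a <= (m i j).-1./2)%N.
Proof. by rewrite mem_iota => ij; lia. Qed.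

Let lambda_seq_uniq (i j : I) : i != j -> uniq (lambda_seq (m i j)).
Proof.
move=> ij; rewrite map_inj_in_uniq ?iota_uniq // => a b.
move=> /(m_gt2 ij) /andP[m2 ha] /(m_gt2 ij) /andP[_ hb] /mulIf e.
apply: (four_cos_sq_inj (c_cos ij m2) ha hb); apply: e; rewrite invr_eq0.
have -> : v ^+ 2 + v ^- 2 + 2 = d ^+ 2 by field.
by rewrite expf_neq0 // (d_neq0 ij).
Qed.

Let lambda_seq_neq0 (i j : I) : i != j -> 0 \notin lambda_seq (m i j).
Proof.
move=> ij; apply/mapP => -[a /(m_gt2 ij) /andP[m2 ha] /esym/eqP].
rewrite mulf_eq0 (negPf (four_cos_sq_eq0 (c_cos ij m2) ha)) invr_eq0 /=.
have -> : v ^+ 2 + v ^- 2 + 2 = d ^+ 2 by field.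
by rewrite expf_eq0 (negPf (d_neq0 ij)).
Qed.

Let couple_eigenvalueP n l : couple_eigenvalue (v ^+ 2) c n l <->
  [\/ l = 1, l \in lambda_seq n | ~~ odd n /\ l = 0].
Proof.
split=> [[->|[a ha ->]|h]|[->|/mapP[a ha ->]|h]].
- by constructor 1.
- by constructor 2; apply: map_f; rewrite mem_iota; lia.
- by constructor 3.
- by constructor 1.
- by constructor 2; exists a => //; move: ha; rewrite mem_iota; lia.
- by constructor 3.
Qed.

Let braid_at (i j : I) := pair_braid (incl i) (retr i) (incl j) (retr j) (A i j) (A j i)
  (lambda_seq (m i j)) (odd (m i j)).

Let tau_braid (i j : I) w : i != j ->
  alt_iter (tau v G i) (tau v G j) (m i j) w = alt_iter (tau v G j) (tau v G i) (m i j) w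
  <-> braid_at i j w.
Proof.
move=> ij; have d0 := d_neq0 ij; rewrite /braid_at lambda_seqE.
apply: (alt_iter_pair_braid _ v_neq0 d0).
- by rewrite mulrDr mulfV // expr2.
- exact: label_retractK.
- exact: label_retractK.
- by move=> x; rewrite Abar_retract.
- by move=> x; rewrite Abar_retract.
- exact: tau_retract.
- exact: tau_retract.
- exact: m_factor.
Qed.

Let retrK (i j : I) : i != j -> forall k x, retr k (incl k x) = x.
Proof. by move=> ij k x; apply: label_retractK; apply: (d_neq0 ij). Qed.

Let A_retr (i j : I) : i != j -> forall k l x, A k l x = retr l (incl k x).
Proof. by move=> ij k l x; apply: Abar_retract; apply: (d_neq0 ij). Qed.

Lemma relations_H_representation :
  hecke_relations m (v ^+ 2) (tau v G) ->
  H_representation (v ^+ 2) c m A /\ Abar_eigenspace_condition v G.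
Proof.
case=> rel _.
have br i j : i != j -> forall w, braid_at i j w by move=> ij w; apply/tau_braid/rel.
have brC i j (ij : i != j) w := iffLR (pair_braidC _ _ _ _ _ _ _ _ _) (br i j ij w).
have fixed i j : i != j -> forall x, A j i (A i j x) = x -> incl i x = incl j (A i j x).
  move=> ij x; apply: (pair_braid_fixed _ _ (br i j ij)).
  - exact: (retrK ij).
  - exact: (A_retr ij).
  - exact: (lambda_seq_neq1 ij).
split; last by move=> i j ij; apply/(Abar_eigenspaceP _ (d_neq0 ij))/fixed.
split=> [i j ij|i j k ij jk ik x|i j k ij jk ik].
- have [s1 s0 us] := And3 (lambda_seq_neq1 ij) (lambda_seq_neq0 ij) (lambda_seq_uniq ij).
  split.
  + split.
      apply: (pair_braid_diagonalizable _ _ _ _ (br i j ij)) => // *;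
      by [apply: (retrK ij) | apply: (A_retr ij)].
    apply: (pair_braid_diagonalizable _ _ _ _ (brC i j ij)) => // *;
    by [apply: (retrK ij) | apply: (A_retr ij)].
  + move=> l lE; apply/couple_eigenvalueP.
    apply: (pair_braid_eigenvalue _ _ _ _ (br i j ij) lE) => *;
    by [apply: (retrK ij) | apply: (A_retr ij)].
  + move=> l lE; apply/couple_eigenvalueP.
    apply: (pair_braid_eigenvalue _ _ _ _ (brC i j ij) lE) => *;
    by [apply: (retrK ij) | apply: (A_retr ij)].
  + move=> om; split=> x.
      apply: (pair_braid_ker _ _ _ (br i j ij)) => // *;
      by [apply: (retrK ij) | apply: (A_retr ij)].
    apply: (pair_braid_ker _ _ _ (brC i j ij)) => // *;
    by [apply: (retrK ij) | apply: (A_retr ij)].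
(* Condition (b): [x] and its image are the same vector of the space on [X], so they have the same
   retraction at [k]. *)
- move/eqlfunP; rewrite comp_lfunE id_lfunE => /(fixed i j ij) xE.
  by rewrite (A_retr ij k) xE -(A_retr ij k).
apply/subvP => _ /memv_imgP[x _ ->].
(* Condition (c) is [pair_braid_image] at a vector included from index [k]. *)
have [y] : exists y, retr j (incl k x) - A i j (retr i (incl k x)) = y - A i j (A j i y).
  apply: (pair_braid_image _ _ (br i j ij)) => *;
  by [apply: (retrK ij) | apply: (A_retr ij) | apply: (lambda_seq_neq1 ij)].
rewrite -!(A_retr ij) add_lfunE opp_lfunE comp_lfunE => ->; apply/memv_imgP.
by exists y; rewrite ?memvf // add_lfunE opp_lfunE id_lfunE comp_lfunE.
Qed.

(** The relation is linear in the vector, and a basis vector whose vertex carries a label [k] lies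
    in the image of [label_incl G k]. *)
Lemma H_representation_relations : nonempty_labels G ->
  H_representation (v ^+ 2) c m A -> Abar_eigenspace_condition v G ->
  hecke_relations m (v ^+ 2) (tau v G).
Proof.
move=> labels [coupleA _ imA] eigA; split; last by move=> i w; apply: tau_quadratic.
move=> i j ij w; apply/(tau_braid w ij).
have ji : j != i by rewrite eq_sym.
have [[diag1 diag2] eig1 eig2 ker12] := coupleA i j ij.
have fixed1 := iffLR (Abar_eigenspaceP _ (d_neq0 ij) i j) (eigA i j ij).
have fixed2 := iffLR (Abar_eigenspaceP _ (d_neq0 ij) j i) (eigA j i ji).
have eig1' l h := iffLR (couple_eigenvalueP _ _) (eig1 l h).
have eig2' l h := iffLR (couple_eigenvalueP _ _) (eig2 l h).
have ker1 om := (ker12 om).1; have ker2 om := (ker12 om).2.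
rewrite [w]ffun_basis; elim/big_rec: _ => [|x u _ brU].
  by rewrite /braid_at /pair_braid !linear0; case: ifP.
apply: pair_braid_linear => //.
have /set0Pn[k kx] := labels x.
have kx' : x \in labelled G k by rewrite inE.
have -> : basis_vec K x = incl k (basis_vec K (Sub x kx')).
  by rewrite linear_extension_basis SubK.
move: (basis_vec K _) => z; have [ki|ki] := eqVneq k i.
  subst k.
  exact: (pair_braid_on1 (retrK ij (k := i)) (A_retr ij j) diag1 eig1' ker1 fixed1).
have [kj|kj] := eqVneq k j.
  subst k; apply/pair_braidC.
  exact: (pair_braid_on1 (retrK ij (k := j)) (A_retr ij i) diag2 eig2' ker2 fixed2).
(* For a label other than [i] and [j], condition (c) supplies the hypothesis of [pair_braid_off]. *)
apply: (pair_braid_off (retrK ij (k := i)) (A_retr ij j) diag1 diag2 eig1' eig2' ker1 ker2 fixed1).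
rewrite -!(A_retr ij).
have jk : j != k by rewrite eq_sym.
have ik : i != k by rewrite eq_sym.
have /memv_imgP[y _] : (A k j - (A i j \o A k i))%VF z \in
    limg (\1 - (A i j \o A j i))%VF.
  by apply: (subvP (imA i j k ij jk ik)); apply: memv_img; rewrite memvf.
rewrite !add_lfunE !opp_lfunE !comp_lfunE id_lfunE => yE.
by exists y.
Qed.

End Characterization.

(** A basis vector with empty label lies in the image of no [label_incl], out of reach of the maps
    [Abar]; hence the converse is stated under [nonempty_labels]. *)
Theorem theorem3p3 (I : finType) (m : I -> I -> nat) (kappa : fieldType)
    (c : nat -> nat -> kappa) (v q : kappa) (G : preWgraph kappa I)
    (m_coxeter : coxeter_matrix m)
    (c_cos : forall i j, i != j -> (2 < m i j)%N ->
       four_cos_sq (m i j) (c (m i j)))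
    (q_v : q = v ^+ 2)
    (q_generic : generic m q) :
  let is_rep := defines_hecke_representation m q (tau v G) in
  let cond12 := H_representation q c m (Abar v G) /\
                Abar_eigenspace_condition v G in
  (is_rep -> cond12) /\
  (nonempty_labels G -> (is_rep <-> cond12)).
Proof.
move=> is_rep cond12; rewrite {}/is_rep {}/cond12; subst q.
have rep_cond : defines_hecke_representation m (v ^+ 2) (tau v G) ->
    H_representation (v ^+ 2) c m (Abar v G) /\ Abar_eigenspace_condition v G.
  move=> /defines_hecke_representationP.
  exact: relations_H_representation m_coxeter c_cos q_generic.
split=> // labels; split=> // -[HA eigA]; apply/defines_hecke_representationP.
exact: H_representation_relations m_coxeter c_cos q_generic labels HA eigA.
Qed.
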